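(* The non-elliptic webs with $12$ black boundary vertices (and no white boundary vertices) are exactly the dihedral translates of the webs $W_1,\dots,W_{32}$ given explicitly in the context. Up to dihedral translation there are $32$ such webs.
   Context: **Webs.** A web ($sl_3$-web) with $12$ black boundary vertices is a planar graph embedded without crossings in a closed disk, with vertices properly coloured black and white (every edge joins a black and a white vertex), with exactly $12$ vertices on the boundary circle, labeled $1,\dots,12$ in clockwise order, all black and all of degree $1$, and with all other (internal) vertices of degree $3$. Webs are considered up to planar isotopy fixing the boundary circle. A web is non-elliptic if it contains no interior faces bounded by four or fewer edges, that is, no contractible cycles (closed loops without vertices), bigons, or squares. (An interior face is a face not touching the boundary circle.) **Dihedral translates.** The dihedral group generated by the rotation $i\mapsto i-1 \pmod{12}$ and the reflection $i\mapsto 13-i$ acts on webs through the rotations and reflections of the disk (it relabels the boundary vertices). A dihedral translate of a web is its image under an element of this group. **Encoding.** Since all boundary vertices are black and every edge joins a white and a black vertex, a web is specified by listing its white internal vertices, each given as the set of its three black neighbours. Numbers $1,\dots,12$ denote boundary vertices and letters $a,b,c,\dots$ denote black internal vertices (each letter occurs in exactly three sets). The web is the non-crossing drawing in the disk with these incidences (unique up to isotopy fixing the boundary). $W_1$: $\{1,2,a\},\{3,a,d\},\{4,b,d\},\{5,6,b\},\{7,b,e\},\{8,c,e\},\{9,10,c\},\{11,c,f\},\{12,a,f\},\{d,e,f\}$. $W_2$: $\{2,3,a\},\{6,7,b\},\{9,10,c\},\{11,12,d\},\{8,b,c\},\{1,a,d\},\{4,a,e\},\{5,b,e\},\{c,d,e\}$.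 $W_3$: $\{2,3,a\},\{4,5,b\},\{7,8,c\},\{10,11,d\},\{12,1,a\},\{a,b,d\},\{6,b,c\},\{9,c,d\}$. $W_4$: $\{2,3,a\},\{5,6,b\},\{8,9,c\},\{12,1,a\},\{7,b,c\},\{11,a,d\},\{4,b,d\},\{10,c,d\}$. $W_5$: $\{1,2,a\},\{4,5,b\},\{7,8,c\},\{10,11,d\},\{3,a,b\},\{6,b,c\},\{9,c,d\},\{12,a,d\}$. $W_6$: $\{1,2,a\},\{3,4,a\},\{5,6,b\},\{7,8,b\},\{9,10,c\},\{11,12,c\},\{a,b,c\}$. $W_7$: $\{1,2,c\},\{3,4,a\},\{5,6,a\},\{9,10,b\},\{11,12,b\},\{7,a,c\},\{8,b,c\}$. $W_8$: $\{1,2,a\},\{4,5,b\},\{6,7,b\},\{8,9,c\},\{10,11,c\},\{3,a,b\},\{12,a,c\}$. $W_9$: $\{1,2,a\},\{3,4,a\},\{6,7,c\},\{8,9,b\},\{10,11,b\},\{5,a,c\},\{12,b,c\}$. $W_{10}$: $\{12,1,2\},\{5,6,a\},\{8,9,b\},\{7,a,b\},\{3,11,c\},\{4,a,c\},\{10,b,c\}$. $W_{11}$: $\{12,1,2\},\{3,4,a\},\{6,7,b\},\{9,10,c\},\{5,a,b\},\{8,b,c\},\{11,a,c\}$. $W_{12}$: $\{1,2,a\},\{3,4,a\},\{5,6,a\},\{7,8,b\},\{9,10,b\},\{11,12,b\}$. $W_{13}$: $\{2,3,a\},\{4,5,a\},\{1,6,a\},\{7,8,b\},\{9,10,b\},\{11,12,b\}$.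 $W_{14}$: $\{2,3,a\},\{4,5,a\},\{1,6,a\},\{8,9,b\},\{10,11,b\},\{7,12,b\}$. $W_{15}$: $\{12,1,2\},\{3,4,a\},\{5,6,a\},\{8,9,b\},\{10,11,b\},\{7,a,b\}$. $W_{16}$: $\{12,1,2\},\{4,5,a\},\{6,7,a\},\{9,10,b\},\{8,a,b\},\{3,11,b\}$. $W_{17}$: $\{12,1,2\},\{3,4,b\},\{5,6,a\},\{7,8,a\},\{10,11,b\},\{9,a,b\}$. $W_{18}$: $\{12,1,2\},\{3,4,a\},\{5,6,a\},\{7,8,b\},\{9,10,b\},\{11,a,b\}$. $W_{19}$: $\{12,1,2\},\{4,5,b\},\{6,7,a\},\{8,9,a\},\{3,11,b\},\{10,a,b\}$. $W_{20}$: $\{12,1,2\},\{3,4,5\},\{6,7,a\},\{8,9,a\},\{10,11,a\}$. $W_{21}$: $\{12,1,2\},\{3,4,5\},\{7,8,a\},\{9,10,a\},\{6,11,a\}$. $W_{22}$: $\{1,2,3\},\{12,4,5\},\{6,7,a\},\{8,9,a\},\{10,11,a\}$. $W_{23}$: $\{1,2,3\},\{12,4,5\},\{7,8,a\},\{9,10,a\},\{6,11,a\}$. $W_{24}$: $\{12,1,2\},\{4,5,6\},\{7,8,a\},\{9,10,a\},\{3,11,a\}$. $W_{25}$: $\{12,1,2\},\{5,6,7\},\{3,4,a\},\{8,9,a\},\{10,11,a\}$. $W_{26}$: $\{12,1,2\},\{5,6,7\},\{4,8,a\},\{9,10,a\},\{3,11,a\}$. $W_{27}$: $\{12,1,2\},\{6,7,8\},\{3,4,a\},\{5,9,a\},\{10,11,a\}$.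 $W_{28}$: $\{12,1,2\},\{3,4,5\},\{6,7,8\},\{9,10,11\}$. $W_{29}$: $\{12,1,2\},\{4,5,6\},\{7,8,9\},\{3,10,11\}$. $W_{30}$: $\{12,1,2\},\{4,5,6\},\{8,9,10\},\{3,7,11\}$. $W_{31}$: $\{12,1,2\},\{6,7,8\},\{3,10,11\},\{4,5,9\}$. $W_{32}$: $\{12,1,2\},\{7,8,9\},\{3,4,11\},\{5,6,10\}$. *)

(* Defs.v *)
(* Mathematical Components *)
From mathcomp Require Import all_boot.

Set Implicit Arguments.
Unset Strict Implicit.
Unset Printing Implicit Defensive.

(* Webs up to isotopy, as combinatorial maps.

   In a properly coloured web every edge has one white and one black end, so
   the drawing near the vertices is recorded by two permutations of the edges:
   rotw (resp. rotb) sends an edge to the next one in clockwise order around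
   its white (resp. black) end.  White (resp. black) vertices are the cycles
   of rotw (resp. rotb), and the length of a cycle is the degree of the vertex.
   bnd i is the edge at the boundary vertex with label i + 1; labels increase
   clockwise along the circle.

   loop is the set of closed curves without vertices.  region is the set of
   connected components of the complement of the web in the disk: left_of e is
   the region on the left of e when e is travelled from its white end to its
   black end, and loop_sides l consists of the two regions on either side of
   the closed curve l.  The regions are part of the data because they say how
   the closed curves and the components of the web that do not reach the
   boundary circle are nested inside the other components. *)
Record diagram := Diagram {
  edge : finType;
  loop : finType;
  region : finType;
  rotw : edge -> edge;
  rotb : edge -> edge;
  bnd : 'I_12 -> edge;
  left_of : edge -> region;
  loop_sides : loop -> {set region}
}.

Section Diagram.
Variable D : diagram.
Implicit Types (e : edge D) (r s : region D).

(* At a white vertex, the region on the right of e is the one on the left of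
   the next edge in clockwise order. *)
Definition right_of e : region D := left_of (rotw e).

(* Walk along e from its white to its black end, keeping the region left_of e
   on the left; turn e is the next edge on the way.  At an internal vertex this
   is the next edge clockwise.  At a boundary vertex one follows the arc of the
   boundary circle to the preceding boundary vertex.  Equivalently, turn is the
   clockwise rotation at black vertices on the sphere obtained by collapsing
   the boundary circle to one black vertex of degree 12. *)
Definition turn e : edge D :=
  if [pick i | bnd D i == e] is Some i then bnd D (ord_pred i) else rotb e.

(* The next edge travelled from white to black on the walk described above:
   the cycles of face are the connected components of the boundaries of the
   regions, other than closed curves. *)
Definition face e : edge D := rotw (turn e).

(* Connectedness in the union of the web and the boundary circle. *)
Definition linked : rel (edge D) :=
  [rel e e' | (rotw e == e') || (turn e == e')].

(* Regions lying on the two sides of an edge or of a closed curve. *)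
Definition adjacent : rel (region D) :=
  [rel r s | [exists e, [set left_of e; right_of e] == [set r; s]]
          || [exists l : loop D, loop_sides l == [set r; s]]].

End Diagram.

(* The last four axioms say that the map is drawn in the disk:
   - the regions are compatible with the walks along their boundaries;
   - Euler's formula V - E + F = 2 holds for every connected component (the
     component of the boundary circle being drawn on the collapsed sphere);
   - the incidence graph between the connected components (closed curves
     included) and the regions, whose edges are the boundary components of
     the regions, is a tree: it is connected, since one can go from any region
     to any other by crossing edges and closed curves, and its number of nodes
     exceeds its number of edges by one. *)
Record web := Web {
  web_diagram :> diagram;
  rotw_inj : injective (@rotw web_diagram);
  rotb_inj : injective (@rotb web_diagram);
  bnd_inj : injective (@bnd web_diagram);
  white_degree : forall e, order (@rotw web_diagram) e = 3;
  black_degree : forall e,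
    order (@rotb web_diagram) e =
      if e \in codom (@bnd web_diagram) then 1 else 3;
  card_loop_sides : forall l : loop web_diagram, #|loop_sides l| = 2;
  left_of_face : forall e : edge web_diagram, left_of (face e) = left_of e;
  component_planar : forall e : edge web_diagram,
    let C := connect (@linked web_diagram) e in
    fcard (@rotw web_diagram) C + fcard (@turn web_diagram) C
      + fcard (@face web_diagram) C = #|C| + 2;
  regions_connected : forall r s, connect (@adjacent web_diagram) r s;
  regions_tree :
    n_comp (@linked web_diagram) (edge web_diagram) + #|loop web_diagram|
      + #|region web_diagram|
    = fcard (@face web_diagram) (edge web_diagram)
      + 2 * #|loop web_diagram| + 1
}.

(* The edge bnd i reaches the circle, and its left side runs into the arc
   between its end and the preceding boundary vertex. *)
Definition interior (w : web) (r : region w) : Prop :=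
  forall i : 'I_12, left_of (bnd w i) <> r.

(* An edge with the same region on both sides is counted twice. *)
Definition face_length (w : web) (r : region w) : nat :=
  #|[set e : edge w | left_of e == r]| + #|[set e : edge w | right_of e == r]|.

Definition non_elliptic (w : web) : Prop :=
  #|loop w| = 0 /\ forall r : region w, interior r -> 4 < face_length r.

(* There is a homeomorphism of the disk that takes w to w', takes the boundary
   vertex i of w to the boundary vertex g i of w', and reverses the orientation
   if and only if mirror is true. *)
Definition disk_image (mirror : bool) (g : 'I_12 -> 'I_12) (w w' : web) :
    Prop :=
  exists (fe : edge w -> edge w') (fl : loop w -> loop w')
         (fr : region w -> region w'),
    [/\ bijective fe, bijective fl & bijective fr] /\
    [/\ forall e, if mirror then rotw (fe (rotw e)) = fe e
                  else rotw (fe e) = fe (rotw e),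
        forall e, if mirror then rotb (fe (rotb e)) = fe e
                  else rotb (fe e) = fe (rotb e),
        forall i, bnd w' (g i) = fe (bnd w i),
        forall e, left_of (fe e) =
                  fr (if mirror then right_of e else left_of e)
      & forall l, loop_sides (fl l) = [set fr r | r in loop_sides l]].

Definition isotopic (w w' : web) : Prop := disk_image false id w w'.

(* The elements of the group generated by i |-> i - 1 and i |-> 13 - i, acting
   on the labels 1, ..., 12 shifted to 0, ..., 11: k-th powers of the rotation
   (mirror = false), possibly preceded by the reflection (mirror = true). *)
Definition dihedral (mirror : bool) (k : nat) (i : 'I_12) : 'I_12 :=
  iter k (@ord_pred 12) (if mirror then rev_ord i else i).

Definition dihedral_translate (w w' : web) : Prop :=
  exists (mirror : bool) (k : nat), disk_image mirror (dihedral mirror k) w w'.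

(* The incidences of w are those listed in code, whose items are the sets of
   neighbours of the white vertices.  wname e is the position in code of the
   white end of e, and bname e is the name of its black end; boundary vertices
   are named by their labels 1, ..., 12. *)
Definition encodes (code : seq (seq nat)) (w : web) : Prop :=
  #|loop w| = 0 /\
  exists wname bname : edge w -> nat,
    [/\ forall e e', wname e = wname e' <-> fconnect (@rotw w) e e',
        forall e e', bname e = bname e' <-> fconnect (@rotb w) e e',
        forall i : 'I_12, bname (bnd w i) = i.+1,
        forall e, perm_eq [seq bname x | x <- orbit (@rotw w) e]
                          (nth [::] code (wname e))
      & forall k, k < size code -> exists e, wname e = k].

(* W_1, ..., W_32 in this order; a, ..., f are names of internal vertices, and
   only need to differ from the labels 1, ..., 12. *)
Definition W_codes : seq (seq (seq nat)) :=
  let a := 13 in let b := 14 in let c := 15 in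
  let d := 16 in let e := 17 in let f := 18 in
  [::
     [:: [:: 1; 2; a]; [:: 3; a; d]; [:: 4; b; d]; [:: 5; 6; b];
         [:: 7; b; e]; [:: 8; c; e]; [:: 9; 10; c]; [:: 11; c; f];
         [:: 12; a; f]; [:: d; e; f]];
     [:: [:: 2; 3; a]; [:: 6; 7; b]; [:: 9; 10; c]; [:: 11; 12; d];
         [:: 8; b; c]; [:: 1; a; d]; [:: 4; a; e]; [:: 5; b; e];
         [:: c; d; e]];
     [:: [:: 2; 3; a]; [:: 4; 5; b]; [:: 7; 8; c]; [:: 10; 11; d];
         [:: 12; 1; a]; [:: a; b; d]; [:: 6; b; c]; [:: 9; c; d]];
     [:: [:: 2; 3; a]; [:: 5; 6; b]; [:: 8; 9; c]; [:: 12; 1; a];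
         [:: 7; b; c]; [:: 11; a; d]; [:: 4; b; d]; [:: 10; c; d]];
     [:: [:: 1; 2; a]; [:: 4; 5; b]; [:: 7; 8; c]; [:: 10; 11; d];
         [:: 3; a; b]; [:: 6; b; c]; [:: 9; c; d]; [:: 12; a; d]];
     [:: [:: 1; 2; a]; [:: 3; 4; a]; [:: 5; 6; b]; [:: 7; 8; b];
         [:: 9; 10; c]; [:: 11; 12; c]; [:: a; b; c]];
     [:: [:: 1; 2; c]; [:: 3; 4; a]; [:: 5; 6; a]; [:: 9; 10; b];
         [:: 11; 12; b]; [:: 7; a; c]; [:: 8; b; c]];
     [:: [:: 1; 2; a]; [:: 4; 5; b]; [:: 6; 7; b]; [:: 8; 9; c];
         [:: 10; 11; c]; [:: 3; a; b]; [:: 12; a; c]];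
     [:: [:: 1; 2; a]; [:: 3; 4; a]; [:: 6; 7; c]; [:: 8; 9; b];
         [:: 10; 11; b]; [:: 5; a; c]; [:: 12; b; c]];
     [:: [:: 12; 1; 2]; [:: 5; 6; a]; [:: 8; 9; b]; [:: 7; a; b];
         [:: 3; 11; c]; [:: 4; a; c]; [:: 10; b; c]];
     [:: [:: 12; 1; 2]; [:: 3; 4; a]; [:: 6; 7; b]; [:: 9; 10; c];
         [:: 5; a; b]; [:: 8; b; c]; [:: 11; a; c]];
     [:: [:: 1; 2; a]; [:: 3; 4; a]; [:: 5; 6; a]; [:: 7; 8; b];
         [:: 9; 10; b]; [:: 11; 12; b]];
     [:: [:: 2; 3; a]; [:: 4; 5; a]; [:: 1; 6; a]; [:: 7; 8; b];
         [:: 9; 10; b]; [:: 11; 12; b]];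
     [:: [:: 2; 3; a]; [:: 4; 5; a]; [:: 1; 6; a]; [:: 8; 9; b];
         [:: 10; 11; b]; [:: 7; 12; b]];
     [:: [:: 12; 1; 2]; [:: 3; 4; a]; [:: 5; 6; a]; [:: 8; 9; b];
         [:: 10; 11; b]; [:: 7; a; b]];
     [:: [:: 12; 1; 2]; [:: 4; 5; a]; [:: 6; 7; a]; [:: 9; 10; b];
         [:: 8; a; b]; [:: 3; 11; b]];
     [:: [:: 12; 1; 2]; [:: 3; 4; b]; [:: 5; 6; a]; [:: 7; 8; a];
         [:: 10; 11; b]; [:: 9; a; b]];
     [:: [:: 12; 1; 2]; [:: 3; 4; a]; [:: 5; 6; a]; [:: 7; 8; b];
         [:: 9; 10; b]; [:: 11; a; b]];
     [:: [:: 12; 1; 2]; [:: 4; 5; b]; [:: 6; 7; a]; [:: 8; 9; a];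
         [:: 3; 11; b]; [:: 10; a; b]];
     [:: [:: 12; 1; 2]; [:: 3; 4; 5]; [:: 6; 7; a]; [:: 8; 9; a];
         [:: 10; 11; a]];
     [:: [:: 12; 1; 2]; [:: 3; 4; 5]; [:: 7; 8; a]; [:: 9; 10; a];
         [:: 6; 11; a]];
     [:: [:: 1; 2; 3]; [:: 12; 4; 5]; [:: 6; 7; a]; [:: 8; 9; a];
         [:: 10; 11; a]];
     [:: [:: 1; 2; 3]; [:: 12; 4; 5]; [:: 7; 8; a]; [:: 9; 10; a];
         [:: 6; 11; a]];
     [:: [:: 12; 1; 2]; [:: 4; 5; 6]; [:: 7; 8; a]; [:: 9; 10; a];
         [:: 3; 11; a]];
     [:: [:: 12; 1; 2]; [:: 5; 6; 7]; [:: 3; 4; a]; [:: 8; 9; a];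
         [:: 10; 11; a]];
     [:: [:: 12; 1; 2]; [:: 5; 6; 7]; [:: 4; 8; a]; [:: 9; 10; a];
         [:: 3; 11; a]];
     [:: [:: 12; 1; 2]; [:: 6; 7; 8]; [:: 3; 4; a]; [:: 5; 9; a];
         [:: 10; 11; a]];
     [:: [:: 12; 1; 2]; [:: 3; 4; 5]; [:: 6; 7; 8]; [:: 9; 10; 11]];
     [:: [:: 12; 1; 2]; [:: 4; 5; 6]; [:: 7; 8; 9]; [:: 3; 10; 11]];
     [:: [:: 12; 1; 2]; [:: 4; 5; 6]; [:: 8; 9; 10]; [:: 3; 7; 11]];
     [:: [:: 12; 1; 2]; [:: 6; 7; 8]; [:: 3; 10; 11]; [:: 4; 5; 9]];
     [:: [:: 12; 1; 2]; [:: 7; 8; 9]; [:: 3; 4; 11]; [:: 5; 6; 10]]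
  ].

(* The code of W_(k+1). *)
Definition W_code (k : 'I_32) : seq (seq nat) := nth [::] W_codes k.

(* Main.v *)
From HB Require Import structures.
Require Import Defs.
From mathcomp Require Import all_boot zify.

Set Implicit Arguments.
Unset Strict Implicit.
Unset Printing Implicit Defensive.

(** A web is determined by the way it can be taken apart from the circle.  Draw a
    closed curve inside the circle and close to it, and let it move inwards.  The
    half-edges just outside the curve, in their order along it, form the cut.  The
    curve passes over one piece at a time, next to a gap between two consecutive
    edges of the cut: a single edge that is both of them (Arc), a vertex on which
    both end (Fork), or two adjacent vertices on which they end (Bridge).

    There always is such a piece.  Give to each region of the part inside the curve
    the weight c + 3 g, where c is its number of corners at vertices and g its number
    of gaps.  By Euler's formula the sum of 6 minus the weight over these regions is
    6, and the moves keep it at least 6 (cut_inv_step).  In a non-elliptic web, a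
    region without gap is an interior face, of weight at least 6; so a region that
    contributes to the sum has one gap and at most two corners, which are the three
    cases above (gap_peelable).  Each contributes at most 3, so the gap between the
    last and the first edges of the cut can be avoided, and the cut is just a list
    (exists_peelable).  All this needs every component of the web to reach the
    circle.  A component that does not would have at least three short faces, by
    Euler's formula again, and they cannot all be filled with other components,
    because components and regions form a tree (non_elliptic_linked).

    So a non-elliptic web is taken apart by a word of pieces, always taking the
    leftmost piece possible, and the word gives back the web (collapses_transfer).
    To enumerate the words, it is enough to know for each gap the colours of its two
    edges and the number of corners that its region has outside the curve: peeling
    closes a face, which needs at least 6 corners.  This search is finite, and finds
    only words of images of W_1, ..., W_32 under the dihedral group
    (survey_sound, W_words_survey); this is the classification.

    The orientations at the vertices, which the lists of incidences leave out, are
    part of the tables from which the W_k are built.  The incidences say which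
    boundary vertices are joined by paths through one or two white vertices, and
    this already tells all the images of the W_k apart (W_separated).  Since a web
    with the incidences of W_k has no bigon and no square, the classification applies
    to it; hence it is isotopic to W_k, and no W_j with j different from k can be a
    dihedral translate of W_k (disk_image_W). *)

(** * Rotations, walks and sides *)

Lemma order_eq3 (T : finType) (f : T -> T) (x : T) :
  f (f (f x)) = x -> f x != x -> order f x = 3.
Proof.
move=> f3 fx.
have ffx : f (f x) != x.
  by apply: contraNneq fx => ffx; rewrite -{1}ffx f3.
suff u : uniq [:: x; f x; f (f x)].
  have c : fcycle f [:: x; f x; f (f x)] by rewrite /= f3 !eqxx.
  by apply: (order_cycle c u); rewrite inE eqxx.
rewrite /= !inE !negb_or eq_sym fx eq_sym ffx /= andbT eq_sym.
by apply: contraNneq fx => ffx'; rewrite -{2}f3 ffx' -{1}ffx'.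
Qed.

Lemma order3P (T : finType) (f : T -> T) (x : T) :
  injective f -> order f x = 3 -> f (f (f x)) = x /\ f x != x.
Proof.
move=> f_inj o3; split; first by have := iter_order f_inj x; rewrite o3.
have := orbit_uniq f x; rewrite /orbit o3 /= !inE negb_or eq_sym.
by case: eqP.
Qed.

Lemma linked_symmetric (D : diagram) :
  injective (@rotw D) -> injective (@turn D) -> connect_sym (@linked D).
Proof.
move=> rotw_inj turn_inj.
have sub f : injective f -> (forall e, linked e (f e)) ->
    forall e, connect (@linked D) (f e) e.
  move=> f_inj lf e.
  have : fconnect f (f e) e by rewrite -(fconnect_sym f_inj) fconnect1.
  by apply: connect_sub => x y /eqP <-; apply: connect1.
have inv e e' : linked e e' -> connect (@linked D) e' e.
  case/orP => /eqP <-; apply: sub.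
  - exact: rotw_inj.
  - by move=> x; apply/orP; left.
  - exact: turn_inj.
  - by move=> x; apply/orP; right.
suff h e e' : connect (@linked D) e e' -> connect (@linked D) e' e.
  by move=> e e'; apply/idP/idP; exact: h.
case/connectP => p; elim: p e => [|x p IH] e /= => [_ ->|]; first exact: connect0.
by case/andP => /inv ex /IH h /h /connect_trans; apply.
Qed.

Section Circle.
Variable D : diagram.
Hypothesis bnd_inj : injective (@bnd D).

Lemma diagram_turn_bnd i : turn (bnd D i) = bnd D (ord_pred i).
Proof.
rewrite /turn; case: pickP => [j /eqP/bnd_inj->//|/(_ i)].
by rewrite eqxx.
Qed.

Lemma circle_linked i j : connect (@linked D) (bnd D i) (bnd D j).
Proof.
suff h n : connect (@linked D) (bnd D i) (bnd D (iter n (@ord_pred 12) i)).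
  suff [n <-] : exists n, iter n (@ord_pred 12) i = j by [].
  exists (i + 12 - j); apply: val_inj => /=.
  have -> : forall n, iter n (@ord_pred 12) i = (i + 11 * n) %% 12 :> nat.
    elim=> [|n IH] /=; first by rewrite muln0 addn0 modn_small.
    rewrite IH; lia.
  by move: (ltn_ord i) (ltn_ord j); lia.
elim: n => [|n IH] /=; first exact: connect0.
by apply: connect_trans IH _; rewrite -diagram_turn_bnd; apply/connect1/orP; right.
Qed.

End Circle.

Section WebBasics.
Variable w : web.
Implicit Types e : edge w.

(** The black end of e is not on the circle. *)
Definition inner e := e \notin codom (@bnd w).

Lemma rotw3 e : rotw (rotw (rotw e)) = e.
Proof. by case: (order3P (@rotw_inj w) (white_degree e)). Qed.

Lemma rotw_neq e : rotw e != e.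
Proof. by case: (order3P (@rotw_inj w) (white_degree e)). Qed.

Lemma rotb_bnd i : rotb (bnd w i) = bnd w i.
Proof.
have := iter_order (@rotb_inj w) (bnd w i).
by rewrite black_degree codom_f.
Qed.

Lemma rotb_neq e : inner e -> rotb e != e.
Proof.
move=> /negbTE inn; have := black_degree e; rewrite inn => /order3P.
by case; first exact: rotb_inj.
Qed.

Lemma rotb3 e : rotb (rotb (rotb e)) = e.
Proof.
have := black_degree e; case: ifP => [/codomP[i ->] _|_ /order3P].
  by rewrite !rotb_bnd.
by case; first exact: rotb_inj.
Qed.

Lemma inner_rotb e : inner (rotb e) = inner e.
Proof.
rewrite /inner; congr negb; apply/codomP/codomP => [[i eq_e]|[i ->]]; exists i.
  by apply: (@rotb_inj w); rewrite rotb_bnd.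
by rewrite rotb_bnd.
Qed.

Lemma turn_bnd i : turn (bnd w i) = bnd w (ord_pred i).
Proof. exact: diagram_turn_bnd (@bnd_inj w) i. Qed.

Lemma turn_inner e : inner e -> turn e = rotb e.
Proof.
rewrite /turn; case: pickP => // i /eqP <-.
by rewrite /inner codom_f.
Qed.

Lemma inner_turn e : inner (turn e) = inner e.
Proof.
case inn: (inner e); first by rewrite turn_inner // inner_rotb.
move/negbFE: inn => /codomP[i ->]; rewrite turn_bnd.
by rewrite /inner codom_f.
Qed.

Lemma turn_inj : injective (@turn w).
Proof.
move=> e e' eq_t; have := inner_turn e; rewrite eq_t inner_turn.
case inn: (inner e) => inn'.
  by move: eq_t; rewrite !turn_inner //; exact: rotb_inj.
move: inn inn' eq_t => /negbFE/codomP[i ->] /negbFE/codomP[j ->].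
by rewrite !turn_bnd => /bnd_inj /(bij_inj (@ord_pred_bij 12)) ->.
Qed.

Lemma face_inj : injective (@face w).
Proof. by move=> e e' /rotw_inj/turn_inj. Qed.

Lemma connect_linked_sym : connect_sym (@linked w).
Proof. exact: linked_symmetric (@rotw_inj w) turn_inj. Qed.

Lemma linked_rotw e : connect (@linked w) e (rotw e).
Proof. by apply/connect1/orP; left. Qed.

Lemma linked_turn e : connect (@linked w) e (turn e).
Proof. by apply/connect1/orP; right. Qed.

Lemma linked_face e : connect (@linked w) e (face e).
Proof. exact: connect_trans (linked_turn e) (linked_rotw _). Qed.

Lemma linked_bnd i j : connect (@linked w) (bnd w i) (bnd w j).
Proof. exact: circle_linked (@bnd_inj w) i j. Qed.

Lemma right_of_face e : right_of (turn e) = left_of e.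
Proof. by rewrite /right_of -(left_of_face e). Qed.

Lemma right_of_inv e : left_of e = right_of (rotw (rotw e)).
Proof. by rewrite /right_of rotw3. Qed.

(** A region along no edge could not be reached from the others by crossing edges. *)
Lemma left_of_surj : #|loop w| = 0 -> forall r : region w,
  exists e, left_of e = r.
Proof.
move=> noloop r; have /connectP[p] := regions_connected r (left_of (bnd w ord0)).
case: p => [_ /= <-|s p /= /andP[/orP[/existsP[e /eqP rs]|/existsP[l _]] _ _]].
- by exists (bnd w ord0).
- have : r \in [set left_of e; right_of e] by rewrite rs !inE eqxx.
  by rewrite !inE => /orP[]/eqP->; [exists e | exists (rotw e)].
- by have := fintype0 l; rewrite noloop => /(_ erefl).
Qed.

Lemma face_length_left (r : region w) : face_length r = 2 * #|[set e | left_of e == r]|.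
Proof.
rewrite /face_length mul2n -addnn; congr (_ + _).
have -> : [set e | left_of e == r] = @rotw w @: [set e | right_of e == r].
  apply/setP => e; rewrite !inE; apply/eqP/imsetP => [<-|[x]].
    by exists (rotw (rotw e)); rewrite ?inE ?rotw3 // -right_of_inv.
  by rewrite inE => /eqP <- ->.
by rewrite card_imset //; exact: rotw_inj.
Qed.

End WebBasics.

(** * Non-elliptic webs have no components off the circle *)

Section Orbits.
Variables (T : finType) (f : T -> T).
Hypothesis f_inj : injective f.

Lemma card_froots (A : {pred T}) : fclosed f A ->
  #|A| = \sum_(x in [predI froots f & A]) order f x.
Proof.
move=> clA; rewrite -sum1_card.
rewrite (partition_big (froot f) [in [predI froots f & A]]) /=; last first.
  move=> x xA; rewrite !inE; apply/andP; split.
    exact: roots_root (fconnect_sym f_inj) x.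
  by rewrite -(closed_connect clA (connect_root _ x)).
apply: eq_bigr => x /andP[/eqP rx xA].
rewrite sum1_card /order; apply: eq_card => y; rewrite unfold_in.
have -> : (froot f y == x) = fconnect f x y.
  by rewrite -(root_connect (fconnect_sym f_inj)) rx eq_sym.
rewrite -[RHS]/(fconnect f x y); case xy: (fconnect f x y); rewrite ?andbF // andbT.
by rewrite -(closed_connect clA xy).
Qed.

End Orbits.

Lemma left_of_fconnect (w : web) (e e' : edge w) :
  fconnect (@face w) e e' -> left_of e = left_of e'.
Proof.
case/connectP => p; elim: p e => [|x p IH] e /= => [_ -> //|].
by case/andP => /eqP <- /IH h /h; rewrite left_of_face.
Qed.

(** The components that do not reach the circle are cubic maps on the sphere, which
    have short faces. *)
Section Linkedness.
Variable w : web.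
Hypothesis w_nonell : non_elliptic w.

Let noloop : #|loop w| = 0. Proof. by case: w_nonell. Qed.

Let circ := connect (@linked w) (bnd w ord0).
Let off : pred (edge w) := [pred e | ~~ circ e].

Let circ_linked e e' : connect (@linked w) e e' -> circ e = circ e'.
Proof. by move=> ee'; rewrite /circ (same_connect_r (@connect_linked_sym w) ee'). Qed.

Let off_linked e e' :
  connect (@linked w) e e' -> (e \in off) = (e' \in off).
Proof. by move=> ee'; rewrite !inE (circ_linked ee'). Qed.

Let off_inner e : off e -> inner e.
Proof.
by apply: contraNN => /codomP[i ->]; exact: linked_bnd.
Qed.

Let off_closed f : (forall e, connect (@linked w) e (f e)) -> fclosed f off.
Proof. by move=> lf e _ /eqP <-; exact: off_linked. Qed.

Let off_rotw := off_closed (@linked_rotw w).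
Let off_turn := off_closed (@linked_turn w).
Let off_face := off_closed (@linked_face w).

Let k := n_comp (@linked w) off.
Let X : pred (edge w) := froots (@face w).
Let short : pred (edge w) := 
  [pred e | [&& X e, off e & order (@face w) e <= 2]].

Let order_turn e : off e -> order (@turn w) e = 3.
Proof.
move=> /off_inner inn; apply: order_eq3; last by rewrite turn_inner ?rotb_neq.
by rewrite !turn_inner ?inner_rotb // rotb3.
Qed.

(** This is Euler's formula summed over the components off the circle. *)
Let euler_off : 3 * fcard (@face w) off = #|off| + 6 * k.
Proof.
have rw3 : fcard (@rotw w) off * 3 = #|off|.
  apply: (fcard_order_set (@rotw_inj w)) off_rotw.
  by apply/subsetP => e _; rewrite inE white_degree.
have tu3 : fcard (@turn w) off * 3 = #|off|.
  apply: (fcard_order_set (@turn_inj w)) off_turn.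
  by apply/subsetP => e oe; rewrite inE order_turn.
suff: fcard (@rotw w) off + fcard (@turn w) off + fcard (@face w) off
      = #|off| + 2 * k by lia.
have split_off (P : pred (edge w)) :
    #|[predI P & off]| = \sum_(z in [predI roots (@linked w) & off])
      #|[predI P & connect (@linked w) z]|.
  rewrite -sum1_card (partition_big (root (@linked w))
            [in [predI roots (@linked w) & off]]) /=; last first.
    move=> x /andP[_ xo].
    rewrite inE /= -(off_linked (connect_root _ x)) xo andbT; apply: roots_root.
    exact: connect_linked_sym.
  apply: eq_bigr => z /andP[/eqP rz zo]; rewrite sum1_card; apply: eq_card => x.
  rewrite unfold_in /= -andbA; congr andb.
  have -> : (root (@linked w) x == z) = connect (@linked w) z x.
    by rewrite -(root_connect (@connect_linked_sym w)) rz eq_sym.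
  rewrite -[RHS]/(connect (@linked w) z x).
  case zx: (connect (@linked w) z x); rewrite ?andbF // andbT.
  by rewrite -(off_linked zx).
have -> : #|off| = #|[predI predT & off]| by apply: eq_card => x; rewrite !inE.
rewrite /n_comp_mem !split_off -!big_split /= mulnC -sum_nat_const -big_split.
apply: eq_bigr => z _; rewrite (component_planar z); congr (_ + _).
Qed.

(** The curvature of the k components off the circle adds up to 2 k, and only short
    faces contribute to it, at most 2/3 each. *)
Let short_many : 3 * k <= #|short|.
Proof.
have offE := card_froots (@face_inj w) off_face.
have : \sum_(x in [predI X & off]) 3 <=
       \sum_(x in [predI X & off]) (order (@face w) x + 2 * short x).
  apply: leq_sum => x /andP[Xx ox].
  have -> : short x = (order (@face w) x <= 2).
    have sx : [&& X x, off x & order (@face w) x <= 2] = (order (@face w) x <= 2).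
      by rewrite (Xx : X x = true) (ox : off x = true).
    exact: sx.
  have := order_gt0 (@face w) x; case: leqP; lia.
rewrite sum_nat_const big_split -offE -big_distrr /=.
have -> : \sum_(x in [predI X & off]) short x = #|short|.
  rewrite -big_mkcondr sum1_card; apply: eq_card => x.
  by apply/andP/idP => [[]//|sx]; split=> //; case/and3P: sx => Xx ox _; apply/andP.
move: euler_off; set a := #|[predI _ & off]|.
by have -> : fcard (@face w) off = a by []; lia.
Qed.

Let X_root e : X (froot (@face w) e).
Proof. exact: roots_root (fconnect_sym (@face_inj w)) e. Qed.

Let left_root e : left_of (froot (@face w) e) = left_of e.
Proof. by rewrite -(left_of_fconnect (connect_root _ e)). Qed.

Let deg (r : region w) := #|[predI X & [pred e | left_of e == r]]|.

Let deg_gt0 r : 0 < deg r.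
Proof.
have [e <-] := left_of_surj noloop r; apply/card_gt0P.
by exists (froot (@face w) e); apply/andP; split; [exact: X_root | rewrite inE left_root].
Qed.

(** A short closed walk off the circle cannot bound a region alone, that region
    being a face with at most four sides. *)
Let short_deg r : #|[predI short & [pred e | left_of e == r]]| <= 2 * (deg r).-1.
Proof.
have [deg2|] := ltnP 1 (deg r).
  apply: (@leq_trans (deg r)); last by lia.
  by apply/subset_leq_card/subsetP => x /andP[/andP[Xx _] xr]; apply/andP.
rewrite leq_eqVlt ltnNge deg_gt0 orbF => d1; rewrite (eqP d1).
have /card1P[x Xr] : #|[predI X & [pred e | left_of e == r]]| == 1 := d1.
have rootx e : left_of e = r -> froot (@face w) e = x.
  move=> er; apply/eqP; rewrite -[_ == x](Xr (froot (@face w) e)).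
  by apply/andP; split; [exact: X_root | rewrite inE left_root er].
rewrite muln0 leqn0; apply/pred0P => y; apply/negP => /andP[/and3P[Xy oy y2] /eqP yr].
have int_r : interior r.
  move=> i /rootx bx; have : y \in off by [].
  rewrite -[y](eqP Xy) (rootx y yr) -bx.
  rewrite -(off_linked (_ : connect (@linked w) (bnd w i) _)).
    by rewrite inE => /negP; apply; exact: linked_bnd.
  have /connectP[p + ->] := connect_root (frel (@face w)) (bnd w i).
  elim: p (bnd w i) => [|e p IH] e' /= => [_|]; first exact: connect0.
  by case/andP => /eqP <- /IH; apply: connect_trans; exact: linked_face.
case: w_nonell => _ /(_ r int_r); rewrite face_length_left ltnNge => /negP; apply.
apply: (@leq_trans (2 * order (@face w) y)); last by lia.
rewrite leq_mul2l /=; apply/subset_leq_card/subsetP => e; rewrite inE => /eqP er.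
rewrite -[_ \in _]/(fconnect (@face w) y e).
rewrite -(root_connect (fconnect_sym (@face_inj w))) (rootx e er).
by rewrite (rootx y yr).
Qed.

(** No closed component: each of them has at least three short faces, which all
    lie in regions with other boundary walks; but the regions and components
    form a tree, which leaves at most two such walks per component. *)
Lemma non_elliptic_linked e : connect (@linked w) (bnd w ord0) e.
Proof.
suff k0 : k = 0.
  apply: contraT => oe; have/card0_eq/(_ (root (@linked w) e)) := k0.
  rewrite !inE roots_root; last exact: connect_linked_sym.
  rewrite -[_ && _]/(root (@linked w) e \in off).
  by rewrite -(off_linked (connect_root _ e)) inE oe.
have degE : \sum_r deg r = #|X|.
  rewrite -sum1_card (partition_big (@left_of w) xpredT) //=.
  by apply: eq_bigr => r _; rewrite sum1_card.
have shortE : \sum_r #|[predI short & [pred e | left_of e == r]]| = #|short|.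
  rewrite -[RHS]sum1_card (partition_big (@left_of w) xpredT) //=.
  by apply: eq_bigr => r _; rewrite sum1_card.
have := regions_tree w; rewrite noloop (n_compC circ) n_comp_connect; last first.
  exact: connect_linked_sym.
have -> : n_comp (@linked w) [predC circ] = k by [].
have -> : fcard (@face w) (edge w) = #|X|.
  by apply: eq_card => x; rewrite !inE andbT.
have : \sum_r ((deg r).-1 + 1) = \sum_r deg r.
  by apply: eq_bigr => r _; rewrite addn1 prednK.
rewrite big_split sum1_card degE /=.
have : \sum_r #|[predI short & [pred e | left_of e == r]]|
        <= \sum_r 2 * (deg r).-1 by apply: leq_sum => r _; exact: short_deg.
rewrite shortE -big_distrr /=; move: short_many.
by rewrite -[#|region w|]/#|predT|; lia.
Qed.

End Linkedness.

(** * Webs linked to the circle *)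

Section Linked.
Variable w : web.
Hypothesis noloop : #|loop w| = 0.
Hypothesis w_linked : forall e, connect (@linked w) (bnd w ord0) e.

Let one_component : n_comp (@linked w) (edge w) = 1.
Proof.
rewrite -(n_comp_connect (@connect_linked_sym w) (bnd w ord0)).
by apply: eq_card => e; rewrite !inE w_linked.
Qed.

Lemma card_region : #|region w| = fcard (@face w) (edge w).
Proof.
by have := regions_tree w; rewrite noloop one_component; lia.
Qed.

(** There are as many regions as faces, so the map from faces to regions, which is
    onto, is one-to-one. *)
Lemma left_of_eq (e e' : edge w) :
  (left_of e == left_of e') = fconnect (@face w) e e'.
Proof.
apply/eqP/idP; last exact: left_of_fconnect.
pose X : {pred edge w} := froots (@face w).
have symf := fconnect_sym (@face_inj w).
have left_root x : left_of (froot (@face w) x) = left_of x.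
  by rewrite -(left_of_fconnect (connect_root _ x)).
have Xroot x : froot (@face w) x \in X by exact: roots_root.
suff inj : {in X &, injective (@left_of w)}.
  by rewrite -(left_root e) -(left_root e') => /inj; move=> /(_ (Xroot _) (Xroot _)) /eqP;
    rewrite root_connect.
apply/image_injP; rewrite (_ : #|X| = #|region w|); last first.
  by rewrite card_region; apply: eq_card => x; rewrite !inE andbT.
rewrite (eq_card (_ : _ =i predT)) // => r; rewrite inE; apply/imageP.
have [x <-] := left_of_surj noloop r.
by exists (froot (@face w) x).
Qed.

(** This is Euler's formula for the whole web: a third of the edges counts the white
    vertices, a third of the inner ones the black vertices besides the circle. *)
Lemma card_region_edge : 3 * #|region w| = #|edge w| + 15.
Proof.
have euler := component_planar (bnd w ord0).
have fcT f : fcard f (connect (@linked w) (bnd w ord0)) = fcard f (edge w).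
  by apply: eq_card => e; rewrite !inE w_linked.
have cT : #|connect (@linked w) (bnd w ord0)| = #|edge w|.
  by apply: eq_card => e; rewrite !inE w_linked.
move: euler; rewrite /= !fcT cT -card_region => euler.
have rw3 : fcard (@rotw w) (edge w) * 3 = #|edge w|.
  apply: (fcard_order_set (@rotw_inj w)) => //.
  by apply/subsetP => e _; rewrite inE white_degree.
pose B : pred (edge w) := [pred e in codom (@bnd w)].
have clB : fclosed (@turn w) [predC B].
  by move=> e _ /eqP <-; rewrite !inE -[_ \notin _]/(inner _) -inner_turn.
have cardB : #|[predC B]| + 12 = #|edge w|.
  have cB : #|B| = 12.
    rewrite -[RHS](card_ord 12) -(card_codom (@bnd_inj w)).
    by apply: eq_card => e; rewrite !inE.
  by rewrite -(cardC B) cB addnC.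
have tu3 : fcard (@turn w) [predC B] * 3 = #|[predC B]|.
  apply: (fcard_order_set (@turn_inj w)) => //.
  apply/subsetP => e eB; have inn : inner e by [].
  rewrite inE; apply/eqP/order_eq3; last by rewrite turn_inner ?rotb_neq.
  by rewrite !turn_inner ?inner_rotb // rotb3.
have tuB : fcard (@turn w) B = 1.
  rewrite -(n_comp_connect (fconnect_sym (@turn_inj w)) (bnd w ord0)).
  apply: eq_card => e; rewrite !inE; congr andb; apply/idP/idP.
    case/codomP => i ->; have iE : exists n, i = iter n (@ord_pred 12) ord0.
      exists (12 - i); apply: val_inj => /=.
      have -> : forall n, iter n (@ord_pred 12) ord0 = 11 * n %% 12 :> nat.
        elim=> [|n IH] //=; rewrite IH; lia.
      by move: (ltn_ord i); lia.
    case: iE => n ->; elim: n => [|n IH] /=; first exact: connect0.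
    by apply: connect_trans IH _; rewrite -turn_bnd; exact: fconnect1.
  case/connectP => p + ->.
  have : bnd w ord0 \in codom (@bnd w) by exact: codom_f.
  elim: p (bnd w ord0) => [|x p IH] y //= yB /andP[/eqP <- pth]; apply: IH pth.
  by move: yB; apply: contraLR; rewrite -![_ \notin _]/(inner _) inner_turn.
have := n_compC B (frel (@turn w)); rewrite tuB.
move: rw3 tu3 cardB euler; move: #|[predC B]| (fcard (@turn w) [predC B]).
move: (fcard (@rotw w) _) (fcard (@turn w) (edge w)) #|edge w| #|region w|.
lia.
Qed.

(** The number of sides of a face is twice the length of its cycle under face, so
    that cycles of length at most 2 are bigons and squares. *)
Lemma short_face (e : edge w) : non_elliptic w ->
  inner e -> inner (face e) -> face (face e) = e -> False.
Proof.
move=> [_ nonell] inn innf ff.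
have cyc : fcycle (@face w) [:: e; face e] by rewrite /= ff !eqxx.
have orbE x : fconnect (@face w) e x -> x \in [:: e; face e].
  by rewrite (fconnect_cycle cyc) // inE eqxx.
have int_e : interior (left_of e).
  move=> i /esym/eqP; rewrite left_of_eq => /orbE; rewrite !inE.
  by case/orP => /eqP bE; [move: inn|move: innf]; rewrite -bE /inner codom_f.
have := nonell _ int_e; rewrite face_length_left ltnNge => /negP; apply.
apply: (@leq_trans (2 * size [:: e; face e])) => //.
rewrite leq_mul2l; apply: (@leq_trans #|[:: e; face e]|); last exact: card_size.
by apply/subset_leq_card/subsetP => x; rewrite inE eq_sym left_of_eq => /orbE.
Qed.

Lemma non_elliptic_faces :
  (forall e : edge w, inner e -> inner (face e) -> face (face e) <> e) ->
  non_elliptic w.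
Proof.
move=> noshort; split=> // r int_r; rewrite face_length_left.
rewrite ltnNge (_ : 4 = 2 * 2) // leq_mul2l /=; apply/negP => card2.
have [e er] := left_of_surj noloop r.
have inner_r x : left_of x = r -> inner x.
  by move=> xr; apply/negP => /codomP[i xE]; apply: (int_r i); rewrite -xE.
have fr : left_of (face e) = r by rewrite left_of_face.
apply: (noshort e); [exact: inner_r | exact: inner_r |].
apply/eqP; apply: contraLR card2 => ffe; rewrite -ltnNge.
have fe : face e != e.
  by apply: contraNneq ffe => fe; rewrite fe fe.
have u : uniq [:: e; face e; face (face e)].
  rewrite /= !inE !negb_or eq_sym fe eq_sym ffe /= andbT.
  by rewrite -(inj_eq (@face_inj w)) in fe; rewrite eq_sym.
apply: leq_trans (_ : #|[set x in [:: e; face e; face (face e)]]| <= _).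
  by rewrite cardsE (card_uniqP u).
apply/subset_leq_card/subsetP => x; rewrite !inE.
by case/or3P => /eqP ->; rewrite ?left_of_face er.
Qed.

End Linked.

(** * Homeomorphisms from bijections of the edges *)

Section DiskImage.
Variables (w w' : web) (mirror : bool) (g : 'I_12 -> 'I_12).
Variable fe : edge w -> edge w'.
Hypotheses (noloop : #|loop w| = 0) (noloop' : #|loop w'| = 0).
Hypothesis w_linked : forall e, connect (@linked w) (bnd w ord0) e.
Hypothesis w'_linked : forall e, connect (@linked w') (bnd w' ord0) e.
Hypothesis fe_bij : bijective fe.
Hypothesis fe_rotw : forall e,
  if mirror then rotw (fe (rotw e)) = fe e else rotw (fe e) = fe (rotw e).
Hypothesis fe_rotb : forall e,
  if mirror then rotb (fe (rotb e)) = fe e else rotb (fe e) = fe (rotb e).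
Hypothesis fe_bnd : forall i, bnd w' (g i) = fe (bnd w i).
Hypothesis g_pred : forall i,
  if mirror then ord_pred (g (ord_pred i)) = g i
  else ord_pred (g i) = g (ord_pred i).

Let fe_inj : injective fe := bij_inj fe_bij.

Let fe_inner e : inner (fe e) -> inner e.
Proof. by apply: contra => /codomP[i ->]; rewrite -fe_bnd codom_f. Qed.

Let fe_turn e : inner e -> inner (fe e) ->
  if mirror then turn (fe (turn e)) = fe e else turn (fe e) = fe (turn e).
Proof.
move=> inn inn'; have := fe_rotb e; rewrite (turn_inner inn).
case: mirror fe_rotb => [_ h|_ <-]; last by rewrite turn_inner.
by rewrite turn_inner // -inner_rotb h.
Qed.

Let fe_turn_bnd i :
  if mirror then turn (fe (turn (bnd w i))) = fe (bnd w i)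
  else turn (fe (bnd w i)) = fe (turn (bnd w i)).
Proof.
by have := g_pred i; case: mirror => h; rewrite !turn_bnd -!fe_bnd !turn_bnd h.
Qed.

Hypothesis g_bij : bijective g.

Let fe_innerE e : inner (fe e) = inner e.
Proof.
apply/idP/idP; first exact: fe_inner.
apply: contra => /codomP[j]; have [h _ hK] := g_bij.
by rewrite -(hK j) fe_bnd => /fe_inj ->; exact: codom_f.
Qed.

Let feT e :
  if mirror then turn (fe (turn e)) = fe e else turn (fe e) = fe (turn e).
Proof.
case inn: (inner e); first by apply: fe_turn; rewrite ?fe_innerE.
by move/negbFE: inn => /codomP[i ->]; exact: fe_turn_bnd.
Qed.

(** The left side of e goes to the left side of h e; a reflection exchanges the
    sides, and the right side of fe e is the left side of the next edge. *)
Let h e := if mirror then rotw (fe e) else fe e.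

Let h_inj : injective h.
Proof. by rewrite /h; case: mirror => [e e' /rotw_inj/fe_inj|]. Qed.

Let h_bij : bijective h.
Proof.
rewrite /h; case: mirror => //; apply: bij_comp fe_bij.
exact: injF_bij (@rotw_inj w').
Qed.

(** A reflection reverses the walks along the boundaries of the regions. *)
Let h_face e : if mirror then face (h (face e)) = h e
                else face (h e) = h (face e).
Proof.
have := feT e; have := fe_rotw (turn e); rewrite /h /face.
by case: mirror => [-> ->|<- <-].
Qed.

Let h_left e e' : (left_of (h e) == left_of (h e')) = (left_of e == left_of e').
Proof.
have step x : left_of (h (face x)) = left_of (h x).
  have := h_face x; rewrite -(left_of_face (h (face x))).
  by case: mirror => [->//|]; rewrite left_of_face => <-; rewrite left_of_face.
have [k hK kK] := h_bij.
have back y : left_of (k (face y)) = left_of (k y).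
  have [x <-] : exists x, h (if mirror then face x else x) = y.
    exists (if mirror then finv (@face w) (k y) else k y).
    by case: mirror; rewrite ?f_finv //; exact: face_inj.
  have := h_face x; case: mirror => ->; by rewrite !hK left_of_face.
apply/idP/idP.
  rewrite left_of_eq // => hh; rewrite -{1}(hK e) -{1}(hK e').
  case/connectP: hh => p + ->; elim: p (h e) => [|x p IH] y //= /andP[/eqP <- yp].
  by rewrite -(eqP (IH _ yp)) back.
rewrite left_of_eq // => /connectP[p + ->].
elim: p e => [|x p IH] y //= /andP[/eqP <- yp].
by rewrite -(eqP (IH _ yp)) step.
Qed.

(** When everything is linked to the circle, the regions are the orbits of the walks
    along their boundaries, so a bijection of the edges carries them along. *)
Lemma disk_image_of_edges : disk_image mirror g w w'.
Proof.
have no_l (l : loop w) : False by have := fintype0 l.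
have no_l' (l : loop w') : False by have := fintype0 l.
pose fl (l : loop w) : loop w' := False_rect _ (no_l l).
have rep (r : region w) : exists e, left_of e == r.
  by have [e <-] := left_of_surj noloop r; exists e.
pose fr (r : region w) := left_of (h (xchoose (rep r))).
have frE e : fr (left_of e) = left_of (h e).
  by apply/eqP; rewrite /fr h_left (xchooseP (rep (left_of e))).
exists fe, fl, fr; split; split=> //.
- by exists (fun l => False_rect _ (no_l' l)) => l; [case: (no_l l)|case: (no_l' l)].
- have [k hK kK] := h_bij.
  have rep' (r : region w') : exists e, left_of (h e) == r.
    have [e <-] := left_of_surj noloop' r; exists (k e).
    by rewrite kK.
  exists (fun r => left_of (xchoose (rep' r))) => r.
    have [e <-] := left_of_surj noloop r; rewrite frE.
    by apply/eqP; rewrite -h_left (xchooseP (rep' _)).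
  by rewrite frE; exact/eqP/(xchooseP (rep' _)).
- move=> e; rewrite /right_of; have := fe_rotw e; have := frE; rewrite /h.
  by case: mirror => -> // ->.
Qed.

End DiskImage.

Section Dihedral.
Variables (mirror : bool) (k : nat).
Notation g := (dihedral mirror k).

Lemma rev_ord_pred (i : 'I_12) : rev_ord (ord_pred i) = ordS (rev_ord i).
Proof. by apply: val_inj => /=; move: (ltn_ord i); lia. Qed.

Lemma dihedral_pred i :
  if mirror then ord_pred (g (ord_pred i)) = g i
  else ord_pred (g i) = g (ord_pred i).
Proof.
rewrite /dihedral; case: mirror.
  by rewrite rev_ord_pred -iterS iterSr ordSK.
by rewrite -iterS iterSr.
Qed.

Lemma dihedral_inj : injective g.
Proof.
suff it_inj : injective (iter k (@ord_pred 12)).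
  by move=> i j /it_inj; case: mirror => // /rev_ord_inj.
elim: k => [|n IH] i j //= /(bij_inj (@ord_pred_bij 12)); exact: IH.
Qed.

Lemma dihedral_bij : bijective g.
Proof. exact: injF_bij dihedral_inj. Qed.

Lemma dihedral_mod : dihedral mirror (k %% 12) =1 g.
Proof.
move=> i; rewrite /dihedral [in RHS](divn_eq k 12) addnC iterD; congr iter.
move: (if _ then _ else _) => j.
elim: (k %/ 12) => [|n IH] //; rewrite mulSn iterD -IH.
by case: {IH} j => j lj; apply: val_inj; do 12?[case: j lj => [|j] lj //].
Qed.

End Dihedral.

(** Reflections exchange the sides of the edges, but keep the walks around the
    regions, so the lengths of the interior faces are kept. *)
Lemma disk_image_non_elliptic (mirror : bool) (g : 'I_12 -> 'I_12) (w w' : web) :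
  bijective g -> disk_image mirror g w w' -> non_elliptic w -> non_elliptic w'.
Proof.
move=> g_bij [fe [fl [fr [[bij_fe bij_fl bij_fr] [_ _ fe_bnd fe_left _]]]]].
move=> [noloop nonell]; split; first by rewrite -noloop; apply/esym/(bij_eq_card bij_fl).
move=> r' int_r'; have [fr' frK fr'K] := bij_fr.
have -> : face_length r' = face_length (fr' r').
  rewrite !face_length_left -(fr'K r') frK; move: (fr' r') => r; congr (_ * _).
  have fe_inj := bij_inj bij_fe.
  have -> : [set e | left_of e == fr r] =
    fe @: [set e | (if mirror then right_of e else left_of e) == r].
    apply/setP => y; rewrite inE; have [h hK kK] := bij_fe.
    apply/eqP/imsetP => [yr|[x]].
      exists (h y); rewrite ?kK // inE; apply/eqP/(bij_inj bij_fr).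
      by rewrite -fe_left kK.
    by rewrite inE => /eqP xr ->; rewrite fe_left xr.
  rewrite card_imset //; case: (mirror) => //.
  rewrite -(card_imset _ (@rotw_inj w)).
  apply: eq_card => e; rewrite [RHS]inE; apply/imsetP/eqP => [[x]|er].
    by rewrite inE => /eqP xr ->.
  by exists (rotw (rotw e)); rewrite ?rotw3 // inE -right_of_inv er.
apply: nonell => i bi; case: mirror fe_left => fe_left; last first.
  by apply: (int_r' (g i)); rewrite fe_bnd fe_left bi fr'K.
have [j jE] : exists j, bnd w i = turn (bnd w j).
  by exists (ordS i); rewrite turn_bnd ordSK.
have rj : right_of (bnd w i) = left_of (bnd w j) by rewrite jE right_of_face.
have [j' j'E] : exists j, bnd w j = turn (bnd w i).
  by exists (ord_pred i); rewrite turn_bnd.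
apply: (int_r' (g (ord_pred i))).
by rewrite fe_bnd fe_left -turn_bnd right_of_face bi fr'K.
Qed.

(** * Taking a web apart from the circle *)

(** What the curve passes over next to a gap: no vertex, one vertex or two. *)
Variant piece := Arc | Fork | Bridge.

Definition corners (t : piece) : nat :=
  match t with Arc => 0 | Fork => 1 | Bridge => 2 end.

(** A list with a position in it is kept as its left part, reversed, and its right
    part; after a move the position goes back by one, as the gap on the left of the
    new edges may have become peelable. *)
Definition step_back (T : Type) (l r : seq T) : seq T :=
  if l is y :: _ then y :: r else r.

Section Moves.
Variables (D : eqType) (rot flip : D -> D).
Implicit Types (a b d : D) (c l r : seq D).

(** The next dart along the boundary of the region on the left of d: go to the
    other end of the edge, and turn clockwise there. *)
Definition onward_by d := rot (flip d).

Definition fits_by t a b : bool := flip b == iter (corners t) onward_by a.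

(** The darts that replace a and b in the cut. *)
Definition joins_by t a b : seq D :=
  match t with
  | Arc => [::]
  | Fork => [:: rot (flip b)]
  | Bridge => [:: rot (onward_by a); rot (flip b)]
  end.

(** The darts at the vertices of the piece, which join the outer side. *)
Definition spent_by t a b : seq D :=
  match t with
  | Arc => [::]
  | Fork => [:: flip a; flip b; rot (flip b)]
  | Bridge => [:: flip a; onward_by a; rot (onward_by a);
                  flip (onward_by a); flip b; rot (flip b)]
  end.

(** Both darts of each edge that no longer meets the inner side; the last dart of
    each vertex stays, as a dart of the cut. *)
Definition gone_by t a b : seq D :=
  match t with
  | Arc => [:: a; b]
  | Fork => [:: a; flip a; b; flip b]
  | Bridge => [:: a; flip a; b; flip b; onward_by a; flip (onward_by a)]
  end.

(** In a word, None moves the position one gap to the right and Some t peels the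
    piece t off at the current gap.  The word has to end with an empty cut. *)
Fixpoint runs (l r : seq D) (m : seq (option piece)) : bool :=
  match m, r with
  | [::], [::] => nilp l
  | None :: m', a :: b :: r' => runs (a :: l) (b :: r') m'
  | Some t :: m', a :: b :: r' =>
    fits_by t a b && runs (behead l) (step_back l (joins_by t a b ++ r')) m'
  | _, _ => false
  end.

End Moves.

(** The search knows each dart of the cut by its colour and by the number of corners
    that the region of the gap on its right has outside; 6 or more stands for no
    information, as for the arcs of the circle.  Skipping a gap asserts that it cannot be
    peeled.  After a Fork or a Bridge the gap on the left has lost one corner inside,
    so that it can only be a Bridge if it could not be peeled before: the search is
    then forced.  Moves that contradict the colours, that close a face with fewer than
    6 corners or that contradict a skip are cut.  The answer is true if every word
    found is good and the fuel suffices. *)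
Section Survey.
Variable good : seq (option piece) -> bool.

Definition mark := (bool * nat)%type.
Implicit Types (a b : mark) (l r : seq mark).

Definition allowed (forced : bool) t a b : bool :=
  [&& (a.1 == b.1) == odd (corners t), 6 <= a.2 + corners t &
      forced ==> if t is Bridge then true else false].

Definition join_marks t a b : seq mark :=
  match t with
  | Arc => [::]
  | Fork => [:: (~~ b.1, b.2.+1)]
  | Bridge => [:: (~~ a.1, 2); (~~ b.1, b.2.+1)]
  end.

Definition bump (T : Type) t k (l : seq (T * nat)) :=
  if l is y :: l' then (y.1, if t is Arc then y.2 + k else y.2.+1) :: l' else [::].

Definition force t (T : Type) (l : seq T) : bool :=
  if t is Arc then false else ~~ nilp l.

Fixpoint survey (fuel : nat) (forced : bool) l r (done : seq (option piece)) :=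
  if fuel is n.+1 then
    match r with
    | [::] => good (rev done)
    (* the gap between the last and the first darts is never the only one *)
    | [:: _] => true
    | a :: b :: r' =>
      survey n false (a :: l) (b :: r') (None :: done) &&
      all (fun t => if allowed forced t a b then
             let l' := bump t b.2 l in
             survey n (force t l) (behead l')
               (step_back l' (join_marks t a b ++ r')) (Some t :: done)
           else true)
        [:: Arc; Fork; Bridge]
    end
  else false.

End Survey.

(** Darts are half-edges: flip goes to the other half, rot turns clockwise around the
    vertex, and lab is the region on the left when one leaves the vertex.  Those in
    core are at vertices off the circle. *)
Section Peeling.
Variables (D L : finType) (rot flip : D -> D) (lab : D -> L) (col : D -> bool).
Variable core : {set D}.
Implicit Types (R : {set D}) (a b d x : D) (c l r : seq D).

Notation onward := (onward_by rot flip).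
Notation fits := (fits_by rot flip).
Notation joins := (joins_by rot flip).
Notation spent := (spent_by rot flip).
Notation gone := (gone_by rot flip).

Hypothesis flipK : involutive flip.
Hypothesis rot3 : forall d, rot (rot (rot d)) = d.
Hypothesis rot_neq : forall d, d \in core -> rot d != d.
Hypothesis col_flip : forall d, col (flip d) = ~~ col d.
Hypothesis col_rot : forall d, col (rot d) = col d.
Hypothesis lab_rot : forall d, d \in core -> lab (flip d) = lab (rot d).

Let rot_inj : injective rot.
Proof. by move=> x y eq_r; rewrite -[x]rot3 eq_r rot3. Qed.
Let flip_inj : injective flip := inv_inj flipK.

Let onward_inj : injective onward.
Proof. by move=> x y /rot_inj/flip_inj. Qed.

Let rot2_neq d : d \in core -> rot (rot d) != d.
Proof.
by move=> /rot_neq; apply: contraNneq => rr; rewrite -{1}rr rot3.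
Qed.

(** The dart b follows a in the cut, with a single region between them. *)
Definition across a b := lab a == lab (flip b).

(** The darts of the edges that meet the inner side of the curve, where R are the
    darts at inner vertices. *)
Definition sheet R c : {set D} := [set d | (d \in R) || (d \in c)].

(** The count is the inequality in Euler's formula that is used: with n = size c, the
    inner side has #|R| / 3 vertices besides the outer one, (#|R| + n) / 2 edges, and
    at least 1 + #|R| / 6 + n / 2 faces, which are counted by their labels. *)
Record cut_inv R c : Prop := CutInv {
  cut_uniq : uniq c;
  cut_out : forall d, d \in c -> d \notin R;
  cut_core : R \subset core;
  cut_rot : forall d, d \in R -> rot d \in R;
  cut_flip : forall d, d \in sheet R c -> flip d \in sheet R c;
  cut_lab : cycle across c;
  cut_count : c != [::] -> 6 + #|R| + 3 * size c <= 6 * #|lab @: sheet R c|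
}.

Lemma sheet_cat R c1 c2 : sheet R (c1 ++ c2) = sheet R (c2 ++ c1).
Proof. by apply/setP => d; rewrite !inE !mem_cat [(d \in c1) || _]orbC. Qed.

Lemma cut_inv_cat R c1 c2 : cut_inv R (c1 ++ c2) -> cut_inv R (c2 ++ c1).
Proof.
move=> [u o co ro fl la ct]; split=> //.
- by rewrite uniq_catC.
- by move=> d; rewrite mem_cat orbC -mem_cat; exact: o.
- by move=> d; rewrite sheet_cat; exact: fl.
- by rewrite -rot_size_cat rot_cycle.
- have -> : size (c2 ++ c1) = size (c1 ++ c2) by rewrite !size_cat addnC.
  rewrite sheet_cat => nc; apply: ct.
  by apply: contraNneq nc; case: (c1) (c2) => [|? ?] [|? ?].
Qed.

Definition shrink R t a b : {set D} := R :\: [set d in spent t a b].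

Definition peelable R t a b : bool :=
  fits t a b &&
  match t with
  | Arc => true
  | Fork => flip a \in R
  | Bridge => (flip a \in R) && (flip (onward a) \in R)
  end.

Lemma path_across b b' a a' r :
  lab b = lab b' -> lab (flip a) = lab (flip a') ->
  path across b (rcons r a) -> path across b' (rcons r a').
Proof.
rewrite /across => eb ea; case: r => [|z r] /=; first by rewrite eb ea.
by rewrite eb !rcons_path /across ea.
Qed.

Section Step.
Variables (R : {set D}) (t : piece) (a b : D) (r : seq D).
Hypothesis inv : cut_inv R [:: a, b & r].
Hypothesis peel : peelable R t a b.

Let R' := shrink R t a b.
Let c' := joins t a b ++ r.

Let aR : a \notin R. Proof. by apply: (cut_out inv); rewrite inE eqxx. Qed.
Let bR : b \notin R. Proof. by apply: (cut_out inv); rewrite !inE eqxx orbT. Qed.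
Let core_R d : d \in R -> d \in core. Proof. exact/subsetP/(cut_core inv). Qed.
Let rR d : d \in r -> d \notin R.
Proof. by move=> dr; apply: (cut_out inv); rewrite !inE dr !orbT. Qed.

Lemma spent_sub d : d \in spent t a b -> d \in R.
Proof.
move: peel; rewrite /peelable /fits_by; case: t => //= [/andP[/eqP-> aR']|].
  by rewrite !inE => /or3P[]/eqP-> //; do ?apply: (cut_rot inv).
case/and3P => [/eqP-> aR' xR]; rewrite !inE.
by do 5?[case/orP => [/eqP->|]] => //; last move/eqP->; do ?apply: (cut_rot inv).
Qed.

(** The two vertices of a Bridge are different since they have different colours. *)
Lemma spent_uniq : uniq (spent t a b).
Proof.
move: peel; rewrite /peelable /fits_by; case: t => //= [/andP[/eqP-> aR']|].
  have ac := core_R aR'.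
  by rewrite !inE negb_or ![flip a == _]eq_sym rot_neq ?rot2_neq //= eq_sym rot_neq
    // core_R ?(cut_rot inv).
case/and3P => [/eqP-> aR' xR]; have ac := core_R aR'; have xc := core_R xR.
have nx : col (onward a) = col (flip a) by rewrite col_rot.
have dif d d' : col d = col (flip a) -> col d' = ~~ col (flip a) -> (d == d') = false.
  by move=> cd cd'; apply/eqP => /(congr1 col); rewrite cd cd'; case: (col _).
have E1 : [/\ (flip a == onward a) = false, (flip a == rot (onward a)) = false &
           (onward a == rot (onward a)) = false].
  split; apply/negbTE; rewrite eq_sym.
  - exact: rot_neq.
  - exact: rot2_neq.
  - by apply: rot_neq; rewrite core_R ?(cut_rot inv).
set y := flip (onward a) in xR xc *.
have E2 : [/\ (y == rot y) = false, (y == rot (rot y)) = false &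
           (rot y == rot (rot y)) = false].
  split; apply/negbTE; rewrite eq_sym.
  - exact: rot_neq.
  - exact: rot2_neq.
  - by apply: rot_neq; rewrite core_R ?(cut_rot inv).
rewrite -[onward (onward a)]/(rot y) !inE.
have cy : col y = ~~ col (flip a) by rewrite /y col_flip nx.
by case: E1 E2 => -> -> -> [-> -> ->]; rewrite !dif ?col_rot ?nx ?cy.
Qed.

Lemma joins_spent d : d \in joins t a b -> d \in spent t a b.
Proof.
by case: (t) => //=; rewrite !inE; [move/eqP-> | case/orP => /eqP->];
  rewrite eqxx ?orbT.
Qed.

Lemma mem_gone d : (d \in gone t a b) =
  [|| d == a, d == b | (d \in spent t a b) && (d \notin joins t a b)].
Proof.
have := spent_uniq; case: (t) => /=; first by rewrite !inE orbF.
  rewrite !inE !negb_or => /andP[/andP[_ xz] /andP[yz _]].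
  case: (d =P flip a) => [->|_]; first by rewrite xz !orbT.
  case: (d =P flip b) => [->|_]; first by rewrite yz !orbT.
  by case: (d == rot _); rewrite !orbF.
rewrite !inE !negb_or -!andbA.
case/and5P=> _ x02 _ _ /and5P[x05 x12 _ _ /and5P[x15 x23 x24 _ /and4P[_ x35 x45 _]]].
case: (d =P flip a) => [->|_]; first by rewrite x02 x05 !orbT.
case: (d =P onward a) => [->|_]; first by rewrite x12 x15 !orbT.
case: (d =P flip (onward a)) => [->|_]; first by rewrite [_ == rot (onward a)]eq_sym x23 x35 !orbT.
case: (d =P flip b) => [->|_]; first by rewrite [_ == rot (onward a)]eq_sym x24 x45 !orbT.
by do 2!case: (d == rot _); rewrite ?orbF ?andbF.
Qed.

Lemma sheet_step d : (d \in sheet R' c') =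
  (d \in sheet R [:: a, b & r]) && (d \notin gone t a b).
Proof.
have u := cut_uniq inv; move: u; rewrite /= inE negb_or => /and3P[/andP[_ ar] br _].
rewrite mem_gone !inE mem_cat.
have [dR|dR] := boolP (d \in R).
  have -> : (d == a) = false by apply: contraNF aR => /eqP <-.
  have -> : (d == b) = false by apply: contraNF bR => /eqP <-.
  have -> : (d \in r) = false by apply: contraTF dR => /rR.
  by case: (d \in joins t a b); case: (d \in spent t a b).
have ds : (d \in spent t a b) = false by apply: contraNF dR => /spent_sub.
have dj : (d \in joins t a b) = false by apply: contraFF ds => /joins_spent.
rewrite ds dj andbF !orbF !negb_or /=.
case: (d =P a) => [->|_]; first by rewrite (negbTE ar).
by case: (d =P b) => [->|_]; rewrite ?andbT // (negbTE br).
Qed.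

Let inS d : d \in R -> d \in sheet R [:: a, b & r].
Proof. by rewrite inE => ->. Qed.

Lemma gone_flip d : (flip d \in gone t a b) = (d \in gone t a b).
Proof.
have fl x y : (flip x == y) = (x == flip y) by rewrite (can2_eq flipK flipK).
move: peel; rewrite /peelable /fits_by; case: (t) => /=.
- by case/andP => /eqP ba _; rewrite !inE !fl -ba flipK orbC.
- by move=> _; rewrite !inE !fl !flipK; do 4!case: eqP => //=.
- by move=> _; rewrite !inE !fl !flipK; do 6!case: eqP => //=.
Qed.

Let keep d : d \in sheet R' c' -> flip d \in sheet R' c'.
Proof.
by rewrite !sheet_step gone_flip => /andP[/(cut_flip inv) -> ->].
Qed.

Let jS d : d \in joins t a b -> d \in sheet R' c'.
Proof. by move=> dj; rewrite inE mem_cat dj orbT. Qed.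

Let core_lab d : d \in R -> lab (flip d) = lab (rot d).
Proof. by move/core_R/lab_rot. Qed.

Let rot_R d : d \in R -> rot d \in R.
Proof. exact: cut_rot inv d. Qed.

Lemma fork_labels : flip a \in R -> flip b = onward a ->
  [/\ lab (flip b) = lab a, lab (rot (flip b)) = lab b
    & lab (flip (rot (flip b))) = lab (flip a)].
Proof.
move=> aR' fb; have bR' : flip b \in R by rewrite fb; exact: rot_R.
split; first by rewrite fb -core_lab ?flipK.
  by rewrite -core_lab ?flipK.
by rewrite core_lab ?rot_R // fb rot3.
Qed.

Lemma bridge_labels : flip a \in R -> flip (onward a) \in R ->
  flip b = onward (onward a) ->
  [/\ lab (flip b) = lab a, lab (onward a) = lab a, lab (rot (flip b)) = lab b,
      lab (flip (rot (onward a))) = lab (flip a)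
    & lab (rot (onward a)) = lab (flip (onward a)) /\
      lab (flip (rot (flip b))) = lab (flip (onward a))].
Proof.
move=> aR' xR fb; have xR' : onward a \in R by exact: rot_R.
have bR' : flip b \in R by rewrite fb; exact: rot_R.
have xa : lab (onward a) = lab a by rewrite -core_lab ?flipK.
split; [| by [] | | | split].
- by rewrite fb -core_lab ?flipK.
- by rewrite -core_lab ?flipK.
- by rewrite core_lab ?rot_R // rot3.
- by rewrite core_lab.
by rewrite core_lab ?rot_R // fb rot3.
Qed.

(** Every region that meets an edge of the piece still meets the inner side along
    the new darts or the next edge of the cut, except for the region of the gap, which the move closes. *)
Lemma lab_step d : d \in sheet R [:: a, b & r] -> c' != [::] ->
  lab d = lab a \/ exists2 d', d' \in sheet R' c' & lab d = lab d'.
Proof.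
move=> dS c'0; have := sheet_step d; rewrite dS /=.
have [dg _|_ dS'] := boolP (d \in gone t a b); last by right; exists d.
have jK x : x \in joins t a b -> flip x \in sheet R' c' by move/jS/keep.
move: c'0 peel dg jK jS; rewrite {1}/c' /peelable /fits_by; case: (t) => /=.
- rewrite andbT => r0 /eqP ba; rewrite !inE => /orP[/eqP->|/eqP->]; first by left.
  move=> _ _; right; have rS : {subset r <= sheet R' c'}.
    by move=> x xr; rewrite inE mem_cat xr !orbT.
  case: (r) r0 rS (cut_lab inv) => [|z r'] //= _ rS /and3P[_ /eqP bz _].
  by exists (flip z); rewrite // keep // rS // inE eqxx.
- move=> _ /andP[/eqP fb aR'] dg jK jS'; have [la lb lc] := fork_labels aR' fb.
  have d3 : rot (flip b) \in [:: rot (flip b)] by rewrite inE eqxx.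
  move: dg; rewrite !inE => /or4P[]/eqP->; [left|right|right|left] => //.
    by exists (flip (rot (flip b))); [exact: jK | rewrite lc].
  by exists (rot (flip b)); [exact: jS' | rewrite lb].
move=> _ /and3P[/eqP fb aR' xR] dg jK jS'.
have [lb lx lq lp [lp' lq']] := bridge_labels aR' xR fb.
have p3 : rot (onward a) \in [:: rot (onward a); rot (flip b)] by rewrite !inE eqxx.
have q3 : rot (flip b) \in [:: rot (onward a); rot (flip b)].
  by rewrite !inE eqxx orbT.
move: dg; rewrite !inE => /or4P[/eqP->|/eqP->|/eqP->|/or3P[]/eqP->]; rewrite ?lb ?lx.
- by left.
- by right; exists (flip (rot (onward a))); [exact: jK | rewrite lp].
- by right; exists (rot (flip b)); [exact: jS' | rewrite lq].
- by left.
- by left.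
by right; exists (rot (onward a)); [exact: jS' | rewrite lp'].
Qed.

Lemma gone_uniq : uniq (gone t a b).
Proof.
have su := spent_uniq; have sR := spent_sub; have u := cut_uniq inv.
have ab : a != b by case/andP: u; rewrite inE negb_or => /andP[].
have aN d : d \in spent t a b -> (a == d) = false.
  by move/sR => dR; apply: contraNF aR => /eqP->.
have bN d : d \in spent t a b -> (b == d) = false.
  by move/sR => dR; apply: contraNF bR => /eqP->.
move: su aN bN; case: (t) => /=; first by rewrite inE ab.
  rewrite !inE !negb_or -!andbA => /and4P[x01 _ _ _] aN bN.
  rewrite ab x01 !aN ?bN ?inE ?eqxx ?orbT //=.
  by rewrite eq_sym bN // inE eqxx.
rewrite !inE !negb_or -!andbA.
case/and5P=> x01 _ x03 x04 /and5P[_ _ x13 x14 /and5P[_ _ _ _ /and3P[x34 _ _]]] aN bN.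
have bN' d : d \in [:: flip a; onward a; rot (onward a); flip (onward a); flip b;
    rot (flip b)] -> (d == b) = false by rewrite eq_sym => /bN.
rewrite ab x01 x03 x04 x13 [flip b == onward a]eq_sym x14
  [flip b == flip _]eq_sym x34.
by rewrite !aN ?bN ?bN' ?inE ?eqxx ?orbT.
Qed.

Lemma gone_sub d : d \in gone t a b -> d \in sheet R [:: a, b & r].
Proof.
rewrite mem_gone inE !inE => /or3P[->|->|/andP[/spent_sub->]] //; by rewrite ?orbT.
Qed.

Lemma card_sheet_step :
  #|sheet R [:: a, b & r]| = #|sheet R' c'| + size (gone t a b).
Proof.
have -> : size (gone t a b) = #|[set d in gone t a b]|.
  by rewrite cardsE (card_uniqP gone_uniq).
rewrite addnC -(cardsID [set d in gone t a b] (sheet R [:: a, b & r])).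
congr (_ + _); last first.
  by apply: eq_card => d; rewrite sheet_step in_setD [X in ~~ X]inE andbC.
by rewrite (setIidPr _) //; apply/subsetP => d; rewrite inE => /gone_sub.
Qed.

Lemma card_shrink : #|R| = #|R'| + size (spent t a b).
Proof.
have -> : size (spent t a b) = #|[set d in spent t a b]|.
  by rewrite cardsE (card_uniqP spent_uniq).
rewrite addnC.
rewrite -(cardsID [set d in spent t a b] R) (setIidPr _) //.
by apply/subsetP => d; rewrite inE => /spent_sub.
Qed.

(** Each move lowers 6 F by at most 6, and #|R| + 3 n by exactly 6. *)
Lemma cut_inv_step : cut_inv R' c'.
Proof.
have peel' := peel; have u := cut_uniq inv.
have jr d : d \in joins t a b -> d \notin r.
  by move/joins_spent/spent_sub => dR; apply: contraTN dR => /rR.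
split.
- rewrite /c' cat_uniq; apply/and3P; split.
  + have := spent_uniq; case: (t) => //=; rewrite !inE !negb_or -!andbA andbT.
    by case/and5P=> _ _ _ _ /and5P[_ _ _ _ /and5P[_ _ _ -> _]].
  + by apply/hasPn => d dr; apply: contraL (dr) => /jr.
  + by case/and3P: u.
- move=> d; rewrite mem_cat inE [d \in [set _ | _]]inE => /orP[/joins_spent->//|/rR].
  by move/negbTE->; rewrite andbF.
- exact: subset_trans (subsetDl _ _) (cut_core inv).
- move=> d; rewrite !inE => /andP[ds dR]; rewrite rot_R // andbT.
  apply: contra ds; move: peel'; rewrite /peelable /fits_by; case: (t) => //=.
    case/andP=> /eqP-> _; rewrite !inE -[onward a]/(rot (flip a)).
    case/or3P => /eqP h; first by rewrite -[d]rot3 h eqxx !orbT.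
      by rewrite (rot_inj h) eqxx.
    by rewrite (rot_inj h) eqxx !orbT.
  case/and3P=> /eqP-> _ _; rewrite !inE -[onward (onward a)]/(rot (flip (onward a))).
  set y := flip (onward a); rewrite /onward_by -/y.
  case/orP => [/eqP h|/or4P[/eqP h|/eqP h|/eqP h|/orP[]/eqP h]].
  + by rewrite -[d]rot3 h eqxx !orbT.
  + by rewrite (rot_inj h) eqxx.
  + by rewrite (rot_inj h) eqxx !orbT.
  + by rewrite -[d]rot3 h eqxx !orbT.
  + by rewrite (rot_inj h) eqxx !orbT.
  + by rewrite (rot_inj h) eqxx !orbT.
- exact: keep.
- have /andP[_ lr] : across a b && path across b (rcons r a) := cut_lab inv.
  move: peel'; rewrite /c' /peelable /fits_by; case: (t) => /=.
  + rewrite andbT; case: (r) lr => [|z r'] //= /andP[/eqP bz lr] /eqP ba.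
    by apply: (path_across _ _ lr); rewrite // -ba flipK.
  + move=> /andP[/eqP fb aR']; have [_ lb lc] := fork_labels aR' fb.
    exact: (path_across (esym lb) (esym lc) lr).
  case/and3P=> /eqP fb aR' xR; have [_ _ lq lp [lp' lq']] := bridge_labels aR' xR fb.
  by rewrite {1}/across lp' lq' eqxx; exact: (path_across (esym lq) (esym lp) lr).
move=> c'0; have /(_ isT) := cut_count inv; rewrite card_shrink.
have : #|lab @: sheet R [:: a, b & r]| <= (#|lab @: sheet R' c'|).+1.
  rewrite -add1n -[1](cards1 (lab a)); apply: leq_trans (leq_card_setU _ _).
  apply/subset_leq_card/subsetP => _ /imsetP[d dS ->]; rewrite inE.
  have [->|[d' d'S ->]] := lab_step dS c'0; first by rewrite inE eqxx.
  by rewrite imset_f ?orbT.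
have : size (spent t a b) + 3 * 2 = 6 + 3 * size (joins t a b) by case: (t).
by rewrite /c' size_cat /=; lia.
Qed.

End Step.
(** Moving onward k times from x leads to y, without touching the circle. *)
Fixpoint walk k x y : bool :=
  if k is k'.+1 then (onward x \in core) && walk k' (onward x) y else x == y.

Lemma walk_cat j k x y z : walk j x y -> walk k y z -> walk (j + k) x z.
Proof.
by elim: j x => [|j IH] x /= => [/eqP->//|/andP[-> /IH h] /h].
Qed.

Lemma walk_iter k x :
  (forall i, i < k -> iter i.+1 onward x \in core) -> walk k x (iter k onward x).
Proof.
elim: k x => [|k IH] x xi; first by rewrite /= eqxx.
rewrite iterSr /= (xi 0) //=; apply: IH => i ik.
by rewrite -iterSr; exact: xi i.+1 ik.
Qed.

Hypothesis no_short : forall d k, 0 < k < 6 -> ~~ walk k d d.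

Section Gaps.
Variables (R : {set D}) (c : seq D).
Hypothesis inv : cut_inv R c.

Definition weight (l : L) : nat :=
  #|[set d in R | lab d == l]| + 3 * count (fun d => lab d == l) c.

(** The walk along the boundary of the region of x goes on inside, or else it reaches
    the cut, next to a gap of the same region. *)
Lemma onward_lab x : x \in sheet R c ->
  [/\ flip x \in R, onward x \in R & lab (onward x) = lab x] \/
  flip x \in c /\ lab (prev c (flip x)) = lab x.
Proof.
move=> xS; have := cut_flip inv xS; rewrite inE => /orP[fR|fc].
  have fcore : flip x \in core := subsetP (cut_core inv) _ fR.
  left; split=> //; first exact: cut_rot inv _ fR.
  by rewrite /onward_by -lab_rot // flipK.
by right; split=> //; have /eqP := prev_cycle (cut_lab inv) fc; rewrite flipK.
Qed.

(** The walk around a region that does not reach the cut closes up inside, around an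
    interior face. *)
Lemma weight_inside (l : L) : l \in lab @: sheet R c ->
  count (fun d => lab d == l) c = 0 -> 6 <= weight l.
Proof.
case/imsetP => x xS -> {l} /eqP; rewrite -leqn0 leqNgt -has_count => noc.
have stay y : y \in sheet R c -> lab y = lab x ->
    y \in R /\ onward y \in R /\ lab (onward y) = lab x.
  move=> yS yx; split.
    move: yS; rewrite inE => /orP[//|yc].
    by case/hasP: noc; exists y; rewrite // yx.
  case: (onward_lab yS) => [[_ -> ->]//|[yc yp]].
  by case/hasP: noc; exists (prev c (flip y)); rewrite ?mem_prev // yp yx.
have iterR n : iter n onward x \in R /\ lab (iter n onward x) = lab x.
  elim: n => [|n [nR nx]]; first by case: (stay x xS erefl).
  by case: (stay (iter n onward x)); rewrite ?inE ?nR // => _ [].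
have coreR y : y \in R -> y \in core := subsetP (cut_core inv) y.
have oinj : injective onward by exact: onward_inj.
rewrite leqNgt; apply/negP => w6.
have o6 : 0 < order onward x < 6.
  rewrite order_gt0 ltnS; apply: leq_trans (_ : weight (lab x) <= _); last by [].
  apply: leq_trans (leq_addr _ _); apply/subset_leq_card/subsetP => y.
  rewrite inE -[_ \in _]/(fconnect onward x y) => /iter_findex <-.
  by have [-> ->] := iterR (findex onward x y); rewrite eqxx.
have /negP := no_short x o6; apply.
rewrite -{3}(iter_order oinj x); apply: walk_iter => i _.
by apply: coreR; case: (iterR i.+1).
Qed.

Lemma weight_total :
  \sum_l weight l = #|R| + 3 * size c.
Proof.
rewrite big_split /= -big_distrr /=; congr (_ + 3 * _).
  rewrite -sum1_card (partition_big lab xpredT) //=; apply: eq_bigr => l _.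
  by rewrite -sum1_card; apply: eq_bigl => d; rewrite inE.
elim: (c) => [|d c' IH] /=; first by rewrite big1.
rewrite big_split /= IH (bigD1 (lab d)) //= eqxx big1 // => l.
by rewrite eq_sym => /negbTE->.
Qed.

(** This is a combinatorial Gauss-Bonnet formula: the curvature 6 of the disk sits in
    regions of weight less than 6, and each of them has a gap. *)
Lemma curvature : c != [::] -> 6 <= \sum_(d <- c) (6 - weight (lab d)).
Proof.
move=> c0; have := cut_count inv c0.
have -> : \sum_(d <- c) (6 - weight (lab d)) =
  \sum_l count (fun d => lab d == l) c * (6 - weight l).
  rewrite (partition_big lab xpredT) //=; apply: eq_bigr => l _.
  rewrite (eq_bigr (fun=> 6 - weight l)) => [|d /eqP-> //].
  by rewrite big_const_seq iter_addn_0 mulnC.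
suff : 6 * #|lab @: sheet R c| <= \sum_l weight l +
    \sum_l count (fun d => lab d == l) c * (6 - weight l).
  by rewrite weight_total; lia.
rewrite -big_split /= mulnC -sum_nat_const big_mkcond /=.
apply: leq_sum => l _; case: ifP => // lS.
case cl: (count _ _) => [|n]; last first.
  by rewrite mulSn addnA; apply: leq_trans (leq_addr _ _); lia.
by rewrite mul0n addn0; exact: weight_inside.
Qed.

End Gaps.

(** The region of the gap has no other gap and at most two corners inside, so the walk
    along its boundary from a gets to b after at most two of them. *)
Lemma gap_peelable R a b r : cut_inv R [:: a, b & r] ->
  weight R [:: a, b & r] (lab a) < 6 -> exists t, peelable R t a b.
Proof.
set c := [:: a, b & r] => inv wa.
have u := cut_uniq inv.
have ac : a \in c by rewrite inE eqxx.
have aR := cut_out inv ac.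
have coreR y : y \in R -> y \in core := subsetP (cut_core inv) y.
have oinj : injective onward by exact: onward_inj.
have ca : 0 < count (fun d => lab d == lab a) c by rewrite -has_count; apply/hasP; exists a.
have only d : d \in c -> lab d = lab a -> d = a.
  move=> dc da; apply/eqP; apply: contraLR wa => dNa; rewrite -leqNgt.
  suff : 2 <= count (fun d => lab d == lab a) c by rewrite /weight; lia.
  have uda : uniq [:: d; a] by rewrite /= inE dNa.
  rewrite -size_filter; apply: leq_trans (_ : size [:: d; a] <= _) => //.
  apply: uniq_leq_size uda _ => x; rewrite !inE mem_filter.
  by case/orP => /eqP->; rewrite ?da eqxx.
have few : #|[set d in R | lab d == lab a]| <= 2 by rewrite /weight in wa; lia.
have step y : y \in sheet R c -> lab y = lab a -> y != flip b ->
    [/\ flip y \in R, onward y \in R & lab (onward y) = lab a].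
  move=> yS ya yb; case: (onward_lab inv yS) => [[-> -> ->]|[yc yp]] //.
  case/eqP: yb; rewrite -[y]flipK; congr flip.
  have pa : prev c (flip y) = a by apply: only; rewrite ?mem_prev // yp.
  by rewrite -(next_prev u (flip y)) pa /= eqxx.
have inS y : y \in R -> y \in sheet R c by rewrite inE => ->.
have aS : a \in sheet R c by rewrite inE ac orbT.
have [ab|ab] := eqVneq a (flip b); first by exists Arc; rewrite /peelable /fits_by -ab eqxx.
have [fa1 y1R y1l] := step a aS erefl ab; set y1 := onward a in y1R y1l.
have [y1b|y1b] := eqVneq y1 (flip b).
  by exists Fork; rewrite /peelable /fits_by -y1b eqxx.
have [fa2 y2R y2l] := step y1 (inS _ y1R) y1l y1b; set y2 := onward y1 in y2R y2l.
have [y2b|y2b] := eqVneq y2 (flip b).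
  by exists Bridge; rewrite /peelable /fits_by -y2b eqxx fa1.
have [fa3 y3R y3l] := step y2 (inS _ y2R) y2l y2b; set y3 := onward y2 in y3R y3l.
have y12 : y1 != y2.
  by apply: contraNneq aR => /oinj ->.
have y23 : y2 != y3.
  by apply: contraNneq y12 => /oinj ->.
have y13 : y1 != y3.
  by apply: contraNneq aR => /oinj ->.
have : #|[set x in [:: y1; y2; y3]]| <= 2.
  apply: leq_trans few; apply/subset_leq_card/subsetP => x; rewrite !inE.
  by case/or3P => /eqP->; rewrite ?y1R ?y2R ?y3R ?y1l ?y2l ?y3l /=.
rewrite cardsE (card_uniqP _) //= !inE !negb_or y12 y13 y23 //.
Qed.

(** A gap holds at most half of the curvature, so some other gap than the one between
    the last and the first darts of the cut can be peeled. *)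
Lemma exists_peelable R c : cut_inv R c -> c != [::] ->
  exists c1 a b c2 t, c = c1 ++ [:: a, b & c2] /\ peelable R t a b.
Proof.
move=> inv c0; have := curvature inv c0.
case/lastP: c => [//|c z] in inv c0 *.
rewrite -cats1 big_cat big_seq1 /= cats1.
have zw : 6 - weight R (rcons c z) (lab z) <= 3.
  suff : 0 < count (fun d => lab d == lab z) (rcons c z) by rewrite /weight; lia.
  by rewrite -has_count; apply/hasP; exists z; rewrite ?mem_rcons ?inE eqxx.
move=> curv; have : 0 < \sum_(d <- c) (6 - weight R (rcons c z) (lab d)) by lia.
rewrite lt0n sum_nat_seq_neq0 => /hasP[a ac wa].
case/splitPr: ac => c1 c2 in inv c0 zw wa curv *.
have [b [c3 cE]] : exists b c3, rcons c2 z = b :: c3.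
  by case: (c2) => [|b c3]; [exists z, [::] | exists b, (rcons c3 z)].
have E : rcons (c1 ++ a :: c2) z = c1 ++ [:: a, b & c3] by rewrite rcons_cat /= cE.
rewrite E in inv wa.
have inv' := cut_inv_cat inv.
have [] := @gap_peelable R a b (c3 ++ c1) inv'.
  move: wa; rewrite /weight !count_cat /= !count_cat /=; lia.
by move=> t pt; exists c1, a, b, c3, t.
Qed.

Hypothesis core_closed : forall R, R \subset core ->
  (forall d, d \in R -> rot d \in R) -> (forall d, d \in R -> flip d \in R) ->
  R = set0.

(** The run of a word on a web, with the inner vertices recorded: the pieces that are
    peeled off have to be inside. *)
Fixpoint collapses R l r (m : seq (option piece)) : Prop :=
  match m, r with
  | [::], [::] => l = [::] /\ R = set0
  | None :: m', a :: b :: r' => collapses R (a :: l) (b :: r') m'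
  | Some t :: m', a :: b :: r' =>
    [/\ cut_inv R [:: a, b & r' ++ rev l], peelable R t a b &
        collapses (shrink R t a b) (behead l) (step_back l (joins t a b ++ r')) m']
  | _, _ => False
  end.

Definition peelable_gap R a b : bool :=
  [|| peelable R Arc a b, peelable R Fork a b | peelable R Bridge a b].

Lemma peelable_sub R R' t a b :
  R' \subset R -> peelable R' t a b -> peelable R t a b.
Proof.
move/subsetP => RR'; rewrite /peelable; case: t => /andP[->] //=; first exact: RR'.
by case/andP => /RR'-> /RR'.
Qed.

Lemma peelable_gapP R a b :
  reflect (exists t, peelable R t a b) (peelable_gap R a b).
Proof.
apply: (iffP or3P) => [[]|[[] h]]; [by exists Arc | by exists Fork | by exists Bridge | ..].
- by constructor 1.
- by constructor 2.
by constructor 3.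
Qed.

Implicit Types (za zb : D * nat) (zl zr : seq (D * nat)).

(** Outside the curve, the boundary of the region of the gap goes from the edge of zb
    to that of za in za.2 steps, unless the mark is 6 or more. *)
Definition gap_mark za zb : bool :=
  (0 < za.2) && ((za.2 < 6) ==> walk za.2 (flip zb.1) za.1).

Definition blocked R za zb : bool := ~~ peelable_gap R zb.1 za.1.

Definition unzip_cut zl zr : seq D := [seq z.1 | z <- catrev zl zr].

(** The marks on the gaps are right, and the gaps that were skipped cannot be peeled. *)
Record scan R (forced : bool) zl zr : Prop := Scan {
  scan_inv : cut_inv R (unzip_cut zl zr);
  scan_mark : sorted gap_mark (catrev zl zr);
  scan_blocked : if zr is za :: _ then path (blocked R) za zl else nilp zl;
  scan_forced : forced -> if zr is [:: za, zb & _]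
    then ~~ peelable R Arc za.1 zb.1 && ~~ peelable R Fork za.1 zb.1 else true
}.

Lemma catrev_sorted (T : Type) (e : rel T) (l : seq T) (x : T) (r : seq T) :
  sorted e (catrev l (x :: r)) = path (fun y z => e z y) x l && path e x r.
Proof.
elim: l x r => [|y l IH] x r //=; rewrite IH /=.
by rewrite andbA [_ && e y x]andbC -andbA.
Qed.

Lemma catrev_step_back (T : Type) (l r : seq T) :
  catrev (behead l) (step_back l r) = catrev l r.
Proof. by case: l. Qed.

Lemma path_split (T : Type) (e : rel T) (x y z : T) (l s1 s2 : seq T) :
  path e x l -> x :: l = s1 ++ [:: y, z & s2] -> e y z.
Proof.
elim: s1 x l => [|u s1 IH] x [|v l] //= pth E; have lE := congr1 behead E.
- by case: E pth => -> -> _ /andP[].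
- by move: lE => /=; case: (s1).
by case/andP: pth => _ /IH; apply.
Qed.

Definition marks zl : seq mark := [seq (col z.1, z.2) | z <- zl].

Definition zjoins t za zb : seq (D * nat) :=
  zip (joins t za.1 zb.1) (unzip2 (join_marks t (col za.1, za.2) (col zb.1, zb.2))).

Lemma unzip_cutE zl zr : unzip_cut zl zr = rev (unzip1 zl) ++ unzip1 zr.
Proof. by rewrite /unzip_cut catrevE map_cat map_rev. Qed.

Section Peel.
Variables (R : {set D}) (forced : bool) (t : piece) (za zb : D * nat).
Variables zl zr : seq (D * nat).
Hypothesis sc : scan R forced zl [:: za, zb & zr].
Hypothesis pk : peelable R t za.1 zb.1.

Let a := za.1.
Let b := zb.1.

Lemma scan_cut : cut_inv R [:: a, b & unzip1 zr ++ rev (unzip1 zl)].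
Proof.
by have := scan_inv sc; rewrite unzip_cutE => /cut_inv_cat.
Qed.

Let core_R d : d \in R -> d \in core := subsetP (cut_core scan_cut) d.
Let rot_R d : d \in R -> rot d \in R := cut_rot scan_cut (d := d).

(** The walks on the two sides of the gap make up the boundary of a face, which
    has at least 6 corners. *)
Lemma allowed_peel : allowed forced t (col a, za.2) (col b, zb.2).
Proof.
have mk : gap_mark za zb.
  by have := scan_mark sc; rewrite catrev_sorted /= => /and3P[].
have /eqP fb : flip b == iter (corners t) onward a by case/andP: pk.
have fo := scan_forced sc; apply/and3P; split=> /=.
- by move: fb; case: (t) => /= /(congr1 col); rewrite /onward_by ?(col_rot, col_flip);
    case: (col a); case: (col b).
- rewrite leqNgt; apply/negP => short.
  case/andP: mk => k0; have k6 : za.2 < 6 by lia.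
  rewrite k6 /= => wk.
  have wc : walk (corners t) a (flip b).
    rewrite fb; apply: walk_iter => i; have := pk; rewrite /peelable -/a.
    case: (t) => //=; first by case: i => [|i] // /andP[_ /rot_R/core_R].
    case: i => [|[|i]] // /and3P[_ /rot_R/core_R + /rot_R/core_R] //.
  have k6' : 0 < za.2 + corners t < 6 by lia.
  by have := no_short (flip b) k6'; rewrite (walk_cat wk wc).
apply/implyP => /fo /andP[nA nF]; move: pk nA nF.
by case: (t) => // ->.
Qed.

Let R' := shrink R t a b.
Let zs := zjoins t za zb.
Let zl' := bump t zb.2 zl.

Let R'_sub : R' \subset R := subsetDl _ _.

Let joins_R d : d \in joins t a b -> d \in R.
Proof. by move/joins_spent/(spent_sub scan_cut pk). Qed.

Lemma marks_peel : marks (behead zl') = behead (bump t zb.2 (marks zl)) /\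
  marks (step_back zl' (zs ++ zr)) =
  step_back (bump t zb.2 (marks zl))
    (join_marks t (col a, za.2) (col b, zb.2) ++ marks zr).
Proof.
have cb : col (rot (flip b)) = ~~ col b by rewrite col_rot col_flip.
have ca : col (rot (onward a)) = ~~ col a by rewrite !col_rot col_flip.
rewrite /zl' /zs /zjoins -/a -/b; split; first by case: (zl).
by case: (zl) => [|y l]; case: (t) => /=; rewrite ?cb ?ca.
Qed.

Lemma unzip_peel : unzip1 (behead zl') = behead (unzip1 zl) /\
  unzip1 (step_back zl' (zs ++ zr)) =
  step_back (unzip1 zl) (joins t a b ++ unzip1 zr).
Proof.
rewrite /zl' /zs /zjoins -/a -/b; split; first by case: (zl).
by case: (zl) => [|y l]; case: (t).
Qed.

Lemma gap_markI (z z' : D * nat) : 0 < z.2 ->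
  (z.2 < 6 -> walk z.2 (flip z'.1) z.1) -> gap_mark z z'.
Proof. by rewrite /gap_mark => -> h; apply/implyP. Qed.

Let fb : flip b = iter (corners t) onward a.
Proof. by case/andP: pk => /eqP. Qed.

(** Around the vertex that is passed, the new dart is followed by the edge of a; so the
    outer walk of the gap on the left gains one corner. *)
Lemma mark_left (y : D * nat) : gap_mark y za ->
  if zs ++ zr is z :: _
  then gap_mark (y.1, if t is Arc then y.2 + zb.2 else y.2.+1) z else true.
Proof.
have := scan_mark sc; rewrite catrev_sorted /= => /and3P[_ _ pb].
case/andP=> y0 /implyP wy; rewrite /zs /zjoins -/a -/b.
move: pk fb; rewrite /peelable; case: (t) => /= pk' fb'.
- case: (zr) pb => [|z zr'] //= /andP[/andP[b0 /implyP wb] _].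
  apply: gap_markI => /=; first by lia.
  move=> k6; rewrite addnC; apply: walk_cat (wb _) _; first by lia.
  by rewrite -/b -(flipK b) fb'; apply: wy; lia.
- case/andP: pk' => _ aR'.
  have rd : onward (flip (rot (flip b))) = flip a by rewrite /onward_by flipK fb' rot3.
  apply: gap_markI => //= k6; rewrite rd core_R //=; apply: wy; lia.
case/and3P: pk' => _ aR' xR.
have rd : onward (flip (rot (onward a))) = flip a by rewrite /onward_by flipK rot3.
apply: gap_markI => //= k6; rewrite rd core_R //=; apply: wy; lia.
Qed.

Lemma mark_right : sorted gap_mark (zs ++ zr).
Proof.
have := scan_mark sc; rewrite catrev_sorted /= => /and3P[_ _ pb].
have last_gap q : onward b = q -> q \in core -> path gap_mark (q, zb.2.+1) zr.
  move=> bq qc; case: (zr) pb => [|z zr'] //= /andP[/andP[b0 /implyP wb] ->].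
  rewrite andbT; apply: gap_markI => // k6.
  rewrite -[walk _ _ _]/(walk zb.2.+1 (flip z.1) q) -addn1; move: k6 => /= k6.
  by apply: walk_cat (wb _) _; [lia | rewrite /= -/b bq qc eqxx].
rewrite /zs /zjoins -/a -/b; move: pk fb; rewrite /peelable.
case: (t) => /= pk' fb'; first exact: path_sorted pb.
  case/andP: pk' => _ aR'; apply: last_gap => //.
  by rewrite fb'; exact/core_R/rot_R/rot_R.
case/and3P: pk' => _ aR' xR; rewrite last_gap //; last first.
  by rewrite fb'; exact/core_R/rot_R/rot_R.
rewrite andbT; apply: gap_markI => //= _.
have -> : onward (flip (rot (flip b))) = flip (onward a).
  by rewrite /onward_by flipK fb' rot3.
by rewrite core_R // -[onward (flip _)]/(rot (flip (flip _))) flipK core_R ?eqxx ?rot_R.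
Qed.

(** For the forced case: if the gap on the left can now be peeled as an Arc or a Fork,
    then it could be peeled as a Fork or a Bridge before, as its region has lost one
    corner inside. *)
Lemma scan_peel :
  scan R' (force t zl) (behead zl') (step_back zl' (zs ++ zr)).
Proof.
have [uE1 uE2] := unzip_peel.
have mk := scan_mark sc.
split.
- rewrite unzip_cutE uE1 uE2 -catrevE catrev_step_back catrevE.
  apply: cut_inv_cat; rewrite -catA.
  exact: cut_inv_step scan_cut pk.
- rewrite catrev_step_back /zl'; have := mark_left.
  case: (zl) mk => [|y l] /=; first by move=> _ _; exact: mark_right.
  rewrite !catrev_sorted /= => /and3P[yl ya _] /(_ y ya) left.
  have -> : path (fun u v => gap_mark v u) (y.1, if t is Arc then y.2 + zb.2
      else y.2.+1) l by case: (l) yl.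
  by move: mark_right left; case: (zs ++ zr) => [|z s] //= -> ->.
- rewrite /zl'; have := scan_blocked sc; case: (zl) => [_|y l] /=; first by case: (zs ++ zr).
  case/andP => _; have sub u v : blocked R u v -> blocked R' u v.
    apply: contra => /peelable_gapP[t' pt']; apply/peelable_gapP; exists t'.
    exact: peelable_sub pt'.
  have bl : path (blocked R) y l -> path (blocked R') y l by exact: sub_path.
  by case: (l) bl.
rewrite /force /zl'; have := scan_blocked sc; case: (zl) => [|y l] /=; first by case: (t).
case/andP => npk _; rewrite /zs /zjoins -/a -/b.
have npk' t' : peelable R t' y.1 a = false.
  by apply: contraNF npk => pt'; apply/peelable_gapP; exists t'.
suff key d : d \in R -> rot d = flip a ->
    ~~ peelable R' Arc y.1 d && ~~ peelable R' Fork y.1 d.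
  have jR := joins_R; move: pk fb jR; rewrite /peelable.
  case: (t) => //= pk' fb' jR _.
    by apply: key; [apply: jR; rewrite inE eqxx | rewrite fb' rot3].
  by apply: key; [apply: jR; rewrite inE eqxx | rewrite rot3].
move=> dR' rd; apply/andP; split.
  apply/negP => /andP[/eqP /= dy _].
  have := npk' Fork; rewrite /peelable /fits_by /= /onward_by -dy flipK rd eqxx.
  by rewrite dR'.
apply/negP => /andP[/eqP /= dy /(subsetP R'_sub) yR].
have := npk' Bridge; rewrite /peelable /fits_by /= {1}/onward_by -dy flipK rd eqxx /=.
by rewrite yR dR'.
Qed.

End Peel.

Lemma survey_sound good fuel forced R zl zr done :
  scan R forced zl zr -> survey good fuel forced (marks zl) (marks zr) done ->
  exists2 m, collapses R (unzip1 zl) (unzip1 zr) m & good (rev done ++ m).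
Proof.
elim: fuel forced R zl zr done => // n IH forced R zl zr done sc.
have [inv mk bl fo] := sc.
case: zr => [|za [|zb zr]] in sc inv mk bl fo *.
- move: bl => /nilP -> in inv *; move=> /= gd; exists [::]; last by rewrite cats0.
  split=> //; apply: core_closed; first exact: cut_core inv.
    exact: cut_rot inv.
  by move=> d dR; have := cut_flip inv (d := d); rewrite !inE dR !orbF => /(_ isT).
- have c0 : unzip_cut zl [:: za] != [::].
    by rewrite unzip_cutE -size_eq0 size_cat addn1.
  have [c1 [a [b [c2 [t [cE pt]]]]]] := exists_peelable inv c0.
  have bl' : path (fun x y => ~~ peelable_gap R y x) za.1 (unzip1 zl).
    by rewrite /unzip1 path_map.
  have lE : za.1 :: unzip1 zl = rev c2 ++ [:: b, a & rev c1].
    rewrite -[LHS]revK rev_cons -cats1 -[X in _ ++ X]/(unzip1 [:: za]).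
    by rewrite -unzip_cutE cE rev_cat !rev_cons -!cats1 -!catA.
  have /negP := path_split bl' lE; case.
  by apply/peelable_gapP; exists t.
case/andP => skip /and4P[pA pF pB _].
have [pk|npk] := boolP (peelable_gap R za.1 zb.1).
  have [t pt] := peelable_gapP _ _ _ pk.
  have [mE1 mE2] := marks_peel t za zb zl zr.
  have [uE1 uE2] := unzip_peel t za zb zl zr.
  have al := allowed_peel sc pt.
  have := IH _ _ _ _ (Some t :: done) (scan_peel sc pt).
  rewrite mE1 mE2 uE1 uE2 => -[].
    by case: (t) al => al; [move: pA|move: pF|move: pB]; rewrite al /force /nilp ?size_map.
  move=> m cm gd; exists (Some t :: m); last by move: gd; rewrite rev_cons -cats1 -catA.
  by split=> //; exact: scan_cut sc.
have sc' : scan R false (za :: zl) (zb :: zr).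
  by split=> //=; rewrite /blocked npk.
have [m cm gd] := IH _ _ _ _ _ sc' skip.
by exists (None :: m) => //; move: gd; rewrite rev_cons -cats1 -catA.
Qed.

(** A piece with n corners contains n + 1 edges. *)
Fixpoint word_weight (m : seq (option piece)) : nat :=
  if m is o :: m' then (if o is Some t then (corners t).+1 else 0) + word_weight m'
  else 0.

Lemma sheet_rev R l r : sheet R (catrev l r) = sheet R (r ++ rev l).
Proof. by rewrite catrevE sheet_cat. Qed.

Lemma collapses_card R l r m : collapses R l r m ->
  #|sheet R (catrev l r)| = 2 * word_weight m.
Proof.
elim: m R l r => [|[t|] m IH] R l [|a [|b r]] //=.
- case=> -> ->; apply: eq_card0 => d; by rewrite !inE.
- case=> inv pk /IH; rewrite catrev_step_back !sheet_rev => E.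
  by rewrite (card_sheet_step inv pk) catA E; case: (t) => /=; lia.
by move=> /IH; rewrite !sheet_rev.
Qed.

(** Two webs with the same word correspond: the darts of the pieces that are peeled off
    are matched in turn, starting from the last piece. *)
Section Transfer.
Variables (D' : eqType) (rot' flip' : D' -> D') (col' : D' -> bool) (d0 : D').
Hypothesis flipK' : involutive flip'.
Hypothesis rot3' : forall d : D', rot' (rot' (rot' d)) = d.
Hypothesis col_flip' : forall d : D', col' (flip' d) = ~~ col' d.
Hypothesis col_rot' : forall d : D', col' (rot' d) = col' d.

Notation onward' := (onward_by rot' flip').
Notation gone' := (gone_by rot' flip').

Definition transfer R c (c' : seq D') (F : D -> D') : Prop :=
  [/\ [seq F d | d <- c] = c',
      forall d, d \in sheet R c -> F (flip d) = flip' (F d) /\ col' (F d) = col d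
    & forall d, d \in R -> F (rot d) = rot' (F d)].

Lemma transfer_step R t a b r (a' b' : D') (r' : seq D') F :
  cut_inv R [:: a, b & r] -> peelable R t a b ->
  fits_by rot' flip' t a' b' -> col' a' = col a -> col' b' = col b ->
  transfer (shrink R t a b) (joins t a b ++ r)
    (joins_by rot' flip' t a' b' ++ r') F ->
  exists F', transfer R [:: a, b & r] [:: a', b' & r'] F'.
Proof.
move=> inv pk /eqP fb' ca cb [mapF Fflip Frot].
pose F1 d := if d \in gone t a b
  then nth d0 (gone' t a' b') (index d (gone t a b)) else F d.
have F1keep d : d \in sheet (shrink R t a b) (joins t a b ++ r) -> F1 d = F d.
  by rewrite (sheet_step inv pk) /F1 => /andP[_ /negbTE->].
have gu := gone_uniq inv pk.
have F1gone i : i < size (gone t a b) ->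
    F1 (nth a (gone t a b) i) = nth d0 (gone' t a' b') i.
  by move=> ig; rewrite /F1 mem_nth // index_uniq.
have Fa : F1 a = a' by have := F1gone 0; case: (t) => /= ->.
have fb : flip b = iter (corners t) onward a by case/andP: pk => /eqP.
have Fb : F1 b = b'.
  by have := F1gone (if t is Arc then 1 else 2); case: (t) => /= ->.
have [mapJ mapR] : [seq F d | d <- joins t a b] = joins_by rot' flip' t a' b' /\
    [seq F d | d <- r] = r'.
  have sz : size (joins t a b) = size (joins_by rot' flip' t a' b') by case: (t).
  move: mapF; rewrite map_cat => /eqP; rewrite eqseq_cat ?size_map //.
  by case/andP => /eqP -> /eqP.
exists F1; split.
- rewrite /= Fa Fb -mapR; congr [:: _, _ & _]; apply/eq_in_map => d dr.
  by apply: F1keep; rewrite inE mem_cat dr !orbT.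
- move=> d dS; case dg: (d \in gone t a b); last first.
    have dS' : d \in sheet (shrink R t a b) (joins t a b ++ r).
      by rewrite (sheet_step inv pk) dS dg.
    have fdS' : flip d \in sheet (shrink R t a b) (joins t a b ++ r).
      by rewrite (sheet_step inv pk) (gone_flip pk) dg (cut_flip inv dS).
    by rewrite !F1keep //; exact: Fflip.
  move: dg F1gone fb fb'; case: (t) => /= dg F1gone fb fb'.
  + move: dg; rewrite !inE => /orP[]/eqP->; rewrite ?Fa ?Fb; split=> //.
      by rewrite -fb flipK Fb -fb' flipK'.
    by rewrite fb Fa fb'.
  + have Ffa := F1gone 1 isT; have Ffb := F1gone 3 isT; rewrite /= in Ffa Ffb.
    by move: dg; rewrite !inE => /or4P[]/eqP->;
      rewrite ?flipK ?Ffa ?Ffb ?flipK' ?Fa ?Fb ?col_flip ?col_flip' ?ca ?cb.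
  have Ffa := F1gone 1 isT; have Ffb := F1gone 3 isT.
  have Fx := F1gone 4 isT; have Ffx := F1gone 5 isT.
  rewrite /= in Ffa Ffb Fx Ffx.
  by move: dg; rewrite !inE => /or4P[/eqP->|/eqP->|/eqP->|/or3P[]/eqP->];
    rewrite ?flipK ?Ffa ?Ffb ?Fx ?Ffx ?flipK' ?Fa ?Fb
      ?(col_flip, col_flip', col_rot, col_rot') ?ca ?cb.
move=> d dR; case ds: (d \in spent t a b); last first.
  have dR' : d \in shrink R t a b by rewrite !inE ds.
  have rR' : rot d \in shrink R t a b by exact: cut_rot (cut_inv_step inv pk) _ dR'.
  have sh x : x \in shrink R t a b -> F1 x = F x.
    by move=> xR; apply: F1keep; rewrite inE xR.
  by rewrite !sh //; exact: Frot.
have Fj j : j \in joins t a b -> F1 j = F j.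
  by move=> jj; apply: F1keep; rewrite inE mem_cat jj orbT.
move: ds Fj F1gone fb fb' mapJ; case: (t) => //= ds Fj F1gone fb fb'.
  case=> mapJ; have Ffa := F1gone 1 isT; have Ffb := F1gone 3 isT.
  rewrite /= in Ffa Ffb.
  have Fd : F1 (rot (flip b)) = rot' (flip' b') by rewrite Fj ?mapJ ?inE.
  move: ds; rewrite !inE => /or3P[]/eqP->; rewrite ?Fd ?Ffa ?Ffb //.
    by rewrite -[rot (flip a)]fb Ffb fb'.
  by rewrite {1}fb rot3 Ffa fb' rot3'.
case=> mapP mapQ; have Ffa := F1gone 1 isT; have Ffb := F1gone 3 isT.
have Fx := F1gone 4 isT; have Ffx := F1gone 5 isT; rewrite /= in Ffa Ffb Fx Ffx.
have Fp : F1 (rot (onward a)) = rot' (onward' a') by rewrite Fj ?mapP ?inE ?eqxx.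
have Fq : F1 (rot (flip b)) = rot' (flip' b') by rewrite Fj ?mapQ ?inE ?eqxx ?orbT.
move: ds; rewrite !inE => /or4P[/eqP->|/eqP->|/eqP->|/or3P[]/eqP->].
- by rewrite Ffa -[rot (flip a)]/(onward a) Fx.
- by rewrite Fp Fx.
- by rewrite Fp -[onward a]/(rot (flip a)) rot3 Ffa rot3'.
- by rewrite Ffx -[rot (flip _)]fb Ffb fb'.
- by rewrite Fq Ffb.
by rewrite Fq {1}fb -[onward (onward a)]/(rot (flip (onward a))) rot3 Ffx fb' rot3'.
Qed.

Lemma transfer_cat R c1 c2 (c1' c2' : seq D') F : size c1 = size c1' ->
  transfer R (c1 ++ c2) (c1' ++ c2') F -> transfer R (c2 ++ c1) (c2' ++ c1') F.
Proof.
move=> sz [mapF Fflip Frot]; split=> [|d|//]; last first.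
  by rewrite sheet_cat; exact: Fflip.
move: mapF; rewrite !map_cat => /eqP.
by rewrite eqseq_cat ?size_map // => /andP[/eqP-> /eqP->].
Qed.

Lemma collapses_transfer R l r m (l' r' : seq D') :
  collapses R l r m -> runs rot' flip' l' r' m ->
  map col' l' = map col l -> map col' r' = map col r ->
  exists F, transfer R (catrev l r) (catrev l' r') F.
Proof.
elim: m R l r l' r' => [|[t|] m IH] R l r l' r'.
- case: r => // -[-> ->]; case: r' => [|//] /nilP -> _ _.
  by exists (fun=> d0); split=> [//|d|d]; rewrite !inE.
- case: r => [//|a [//|b r]] [inv pk /IH IH1].
  case: r' => [//|a' [//|b' r']] /andP[fb' /IH1{IH1} IH1] cl [ca cb cr].
  have sl : size l = size l' by rewrite -(size_map col) -cl size_map.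
  have cj : map col' (joins_by rot' flip' t a' b') = map col (joins t a b).
    by case: (t) => //=; rewrite ?(col_rot, col_rot', col_flip, col_flip') ?cb ?ca.
  case: IH1 => [||F].
  + by case: (l) (l') cl => [|y ?] [|y' ?] //= [_].
  + by case: (l) (l') cl => [|y ?] [|y' ?] //= cl;
      rewrite ?map_cat cj -cr //; case: cl => ->.
  rewrite !catrev_step_back !catrevE => /transfer_cat; rewrite !size_rev -!catA.
  move=> /(_ sl)/(transfer_step inv pk fb' ca cb)[F' tF'].
  exists F'; apply: (@transfer_cat R [:: a, b & r] (rev l) [:: a', b' & r']) => //=.
  by rewrite -(size_map col) -cr size_map.
case: r => [//|a [//|b r]] /IH{}IH; case: r' => [//|a' [//|b' r']] /IH{}IH.
move=> cl [ca cb cr]; apply: IH; first by rewrite /= ca cl.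
by rewrite /= cb cr.
Qed.

End Transfer.

End Peeling.

(** * Words of non-elliptic webs *)

(** A dart is an edge with one of its ends, the white one being marked true. *)
Section Darts.
Variables (E : eqType) (rw rb : E -> E).

Definition dart_rot (d : E * bool) : E * bool :=
  (if d.2 then rw d.1 else rb d.1, d.2).
Definition dart_flip (d : E * bool) : E * bool := (d.1, ~~ d.2).

Lemma dart_flipK : involutive dart_flip.
Proof. by case=> e c; rewrite /dart_flip /= negbK. Qed.

Lemma dart_rot3 : (forall e, rw (rw (rw e)) = e) ->
  (forall e, rb (rb (rb e)) = e) ->
  forall d, dart_rot (dart_rot (dart_rot d)) = d.
Proof. by move=> rw3 rb3 [e [|]]; rewrite /dart_rot /= ?rw3 ?rb3. Qed.

End Darts.

Section WebReduction.
Variable w : web.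
Hypothesis nonell : non_elliptic w.

Let noloop : #|loop w| = 0. Proof. by case: nonell. Qed.
Let w_linked := non_elliptic_linked nonell.

Notation dart := (edge w * bool)%type.
Let rot := dart_rot (@rotw w) (@rotb w).
Let flip := @dart_flip (edge w).
Let lab (d : dart) := if d.2 then left_of d.1 else right_of d.1.
Let core : {set dart} := [set d | d.2 || inner d.1].

Definition circle_cut : seq dart := [seq (bnd w i, false) | i <- enum 'I_12].

Let rot3 : forall d, rot (rot (rot d)) = d.
Proof. exact: dart_rot3 (@rotw3 w) (@rotb3 w). Qed.

Let flipK : involutive flip := @dart_flipK (edge w).

Let col_flip d : (flip d).2 = ~~ d.2. Proof. by []. Qed.
Let col_rot d : (rot d).2 = d.2. Proof. by []. Qed.

Let rot_neq d : d \in core -> rot d != d.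
Proof.
case: d => e [|]; rewrite inE /= xpair_eqE andbT ?rotw_neq //.
exact: rotb_neq.
Qed.

Let lab_rot d : d \in core -> lab (flip d) = lab (rot d).
Proof.
case: d => e [|] //; rewrite inE /lab /= => inn.
by rewrite -(right_of_face e) turn_inner.
Qed.

(** Since the colours alternate along a walk, k is 2 or 4. *)
Let no_short d k : 0 < k < 6 -> ~~ walk rot flip core k d d.
Proof.
have step c e : onward_by rot flip (e, c) =
    if c then (rotb e, false) else (rotw e, true) by case: c.
have faceE (e : edge w) : inner e -> face e = rotw (rotb e).
  by move=> inn; rewrite /face turn_inner.
have inr (e : edge w) : inner (rotb e) -> inner e by rewrite inner_rotb.
case: d => e [|] /andP[k0 k6]; apply/negP.
  case: k k0 k6 => [|[|[|[|[|[|k]]]]]] // _ _; rewrite /= !step !inE /= ?xpair_eqE ?andbT ?andbF //.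
    case/andP=> /inr inn /eqP fe.
    by apply: (@short_face w noloop w_linked e nonell inn); rewrite !faceE ?fe.
  case/and3P=> /inr inn /inr inn' /eqP ff; move: (inn) => /faceE fe.
  by apply: (@short_face w noloop w_linked e nonell inn); rewrite !fe ?faceE.
case: k k0 k6 => [|[|[|[|[|[|k]]]]]] // _ _; rewrite /= !step !inE /= ?xpair_eqE ?andbT ?andbF //.
  case/andP=> /inr inn /eqP fe; have fe' := faceE _ inn; rewrite fe in fe'.
  by apply: (@short_face w noloop w_linked _ nonell inn); rewrite !fe'.
case/and3P=> /inr inn /inr inn' /eqP ff.
have fe := faceE _ inn; have fe' := faceE _ inn'; rewrite ff in fe'.
by apply: (@short_face w noloop w_linked _ nonell inn); rewrite !fe ?fe'.
Qed.

Let core_closed (R : {set dart}) : R \subset core ->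
  (forall d, d \in R -> rot d \in R) -> (forall d, d \in R -> flip d \in R) ->
  R = set0.
Proof.
move=> /subsetP Rc Rr Rf; apply/setP => -[e c]; rewrite inE; apply/negP => eR.
have {c}eR : (e, true) \in R by case: c eR => // /Rf.
have : connect (@linked w) e (bnd w ord0) by rewrite connect_linked_sym.
case/connectP => p + bE; suff : (bnd w ord0, false) \notin R.
  rewrite bE => /negP notR pth; apply: notR; apply: (Rf (_, true)).
  elim: p e eR pth {bE} => [|x p IH] e //= eR /andP[/orP[]/eqP <-]; apply: IH.
    exact: Rr (e, true) eR.
  have eR' := Rf _ eR; have := Rc _ eR'; rewrite inE /= => /turn_inner ->.
  exact: Rf (_, false) (Rr _ eR').
by apply/negP => /Rc; rewrite inE /= /inner codom_f.
Qed.

Let sheet_circle : sheet core circle_cut = setT.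
Proof.
have inj : injective (fun i => (bnd w i, false)) by move=> i j [/bnd_inj].
apply/setP => -[e c]; rewrite !inE /=; case: c => //=.
rewrite /inner; case: (boolP (e \in codom _)) => //= /codomP[i ->].
by rewrite (mem_map inj) mem_enum.
Qed.

(** The count is Euler's formula for the web. *)
Let circle_inv : cut_inv rot flip lab core core circle_cut.
Proof.
have inj : injective (fun i => (bnd w i, false)) by move=> i j [/bnd_inj].
split.
- by rewrite (map_inj_uniq inj) enum_uniq.
- by move=> _ /mapP[i _ ->]; rewrite inE /= /inner codom_f.
- exact: subxx.
- by case=> e [|]; rewrite !inE //= inner_rotb.
- by move=> d _; rewrite sheet_circle.
- rewrite cycle_map; have : cycle (fun i j => i == (j + 11) %% 12) (iota 0 12) by [].
  rewrite -val_enum_ord cycle_map; apply: sub_cycle => i j /eqP ij.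
  have -> : i = ord_pred j by apply: val_inj; move: ij => /= ->; lia.
  by rewrite /= /across /lab /= -turn_bnd right_of_face.
move=> _; rewrite sheet_circle.
have -> : #|lab @: setT| = #|region w|.
  apply: eq_card => r; rewrite [RHS]inE; apply/imsetP.
  by have [e <-] := left_of_surj noloop r; exists (e, true).
have := card_region_edge noloop w_linked.
have -> : size circle_cut = 12 by rewrite size_map size_enum_ord.
have : #|core| + 12 = #|{: dart}|.
  rewrite -(cardsC core); congr (_ + _).
  rewrite -[LHS]/12 -[LHS](card_ord 12) -(card_imset _ inj).
  apply: eq_card => -[e c]; rewrite !inE negb_or.
  apply/imsetP/andP => [[i _ [-> ->]]|[]] /=; first by rewrite /inner negbK codom_f.
  by case: c => //= _; rewrite /inner negbK => /codomP[i ->]; exists i.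
rewrite card_prod card_bool; move: #|core| #|edge w| #|region w|.
by lia.
Qed.

Definition word_collapses (m : seq (option piece)) : Prop :=
  collapses rot flip lab core core [::] circle_cut m.

Lemma non_elliptic_word good fuel :
  survey good fuel false [::] (nseq 12 (false, 6)) [::] ->
  exists2 m, word_collapses m & good m.
Proof.
move=> surv; pose zr := [seq (d, 6) | d <- circle_cut].
have const (T T' : Type) (x : T') (s : seq T) : [seq x | _ <- s] = nseq (size s) x.
  by elim: s => //= _ s ->.
have zrE : unzip1 zr = circle_cut by rewrite /unzip1 -map_comp map_id.
have mE : marks snd zr = nseq 12 (false, 6).
  rewrite /marks /zr /circle_cut -!map_comp.
  by rewrite (eq_map (_ : _ =1 fun=> (false, 6))) // const -enumT size_enum_ord.
have sc : scan rot flip lab core core false [::] zr.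
  split=> //; last by case: (zr).
    by rewrite /unzip_cut /= -/(unzip1 zr) zrE; exact: circle_inv.
  rewrite /= /zr; case: circle_cut => [|d s] //=.
  by elim: s d => [|d' s IH] d //=; rewrite IH andbT.
have surv' : survey good fuel false [::] (marks snd zr) [::].
  by rewrite mE.
have [] := @survey_sound _ _ rot flip lab snd core flipK rot3 rot_neq col_flip
  col_rot lab_rot no_short core_closed good fuel false core [::] zr [::] sc surv'.
by rewrite zrE => m; exists m.
Qed.

(** The rotations rw and rb need not come from a web, and neither is f onto in
    general: the word only says how to label the edges of w. *)
Lemma word_transfer m (E : eqType) (e0 : E) (rw rb : E -> E) (bd : seq E) :
  word_collapses m ->
  (forall e, rw (rw (rw e)) = e) -> (forall e, rb (rb (rb e)) = e) ->
  runs (dart_rot rw rb) (@dart_flip E) [::] [seq (e, false) | e <- bd] m ->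
  size bd = 12 -> (forall e, e \in bd -> rb e = e) ->
  #|edge w| = word_weight m /\
  exists f : edge w -> E,
    [/\ forall e, f (rotw e) = rw (f e), forall e, f (rotb e) = rb (f e)
      & forall i : 'I_12, f (bnd w i) = nth e0 bd i].
Proof.
move=> cm rw3 rb3 rm sz bd_fix; split.
  have := collapses_card rot3 rot_neq col_flip col_rot cm.
  rewrite /= sheet_circle cardsT card_prod card_bool mulnC => /eqP.
  by rewrite eqn_pmul2l // => /eqP.
have szE : map snd [seq (e, false) | e <- bd] = map snd circle_cut.
  have const (T T' : Type) (f : T -> T') s :
      map snd [seq (f x, false) | x <- s] = nseq (size s) false.
    by elim: s => //= _ s ->.
  by rewrite (const _ _ id) (const _ _ (bnd w)) sz size_enum_ord.
have [F [Fc Ff Fr]] := collapses_transfer flipK rot3 rot_neq col_flip col_rot lab_rot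
  (e0, true) (@dart_flipK E) (dart_rot3 rw3 rb3) (fun d : E * bool => erefl (~~ d.2)) (fun d => erefl d.2)
  cm rm erefl szE.
have Fflip d : F (flip d) = dart_flip (F d).
  by case: (Ff d); rewrite // /= sheet_circle inE.
have Fcol d : (F d).2 = d.2.
  by case: (Ff d); rewrite // /= sheet_circle inE.
exists (fun e => (F (e, true)).1); have FE e c : F (e, c) = ((F (e, true)).1, c).
  have := Fcol (e, true); case Fe: (F (e, true)) => [x y] /= yE; subst y.
  by case: c => //; have := Fflip (e, true); rewrite Fe.
have fbnd (i : 'I_12) : (F (bnd w i, true)).1 = nth e0 bd i.
  have isz : i < size (enum 'I_12) by rewrite size_enum_ord.
  have := congr1 (fun s => nth (e0, false) s i) Fc; rewrite /= /circle_cut -map_comp.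
  rewrite (nth_map i) // nth_ord_enum /= FE (nth_map e0) ?sz //.
  by case.
split=> [e|e|//].
- have := Fr (e, true); rewrite inE => /(_ isT).
  by rewrite [F (e, true)]FE /rot {1}/dart_rot /= => ->.
case inn: (inner e).
  have := Fr (e, false); rewrite inE => /(_ inn).
  by rewrite /rot /dart_rot /= ![F (_, false)]FE => -[].
move/negbFE: inn => /codomP[i ->]; rewrite rotb_bnd fbnd bd_fix //.
by apply: mem_nth; rewrite sz.
Qed.

End WebReduction.

(** * Incidences *)

(** Where one gets from a boundary vertex by crossing n white vertices depends on the
    incidences only, not on the orientations at the vertices. *)
Fixpoint near (w : web) (n : nat) (i : 'I_12) (e : edge w) : Prop :=
  if n is n'.+1 then
    exists e1 e2, [/\ near n' i e1, fconnect (@rotw w) e1 e2 & fconnect (@rotb w) e2 e]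
  else e = bnd w i.

Definition reach (code : seq (seq nat)) (n i : nat) : seq nat :=
  iter n (fun s => undup (flatten [seq c <- code | has [in s] c])) [:: i].

Lemma fconnect_bnd (w : web) i (e : edge w) : fconnect (@rotb w) (bnd w i) e -> e = bnd w i.
Proof.
case/connectP => p + ->; elim: p => [|x p IH] //= /andP[/eqP <-].
by rewrite rotb_bnd.
Qed.

Lemma eq_on_uniq_map (T U : eqType) (f : T -> U) (s : seq T) x y :
  uniq (map f s) -> x \in s -> y \in s -> f x = f y -> x = y.
Proof.
elim: s => //= z s IH /andP[zs us]; rewrite !inE.
case/orP=> [/eqP->|xs]; case/orP => [/eqP->|ys] // fxy; last exact: IH.
  by case/negP: zs; rewrite fxy map_f.
by case/negP: zs; rewrite -fxy map_f.
Qed.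

Section Encodes.
Variables (code : seq (seq nat)) (w : web) (wname bname : edge w -> nat).
Hypothesis wnameP : forall e e', wname e = wname e' <-> fconnect (@rotw w) e e'.
Hypothesis bnameP : forall e e', bname e = bname e' <-> fconnect (@rotb w) e e'.
Hypothesis bname_bnd : forall i : 'I_12, bname (bnd w i) = i.+1.
Hypothesis white_set : forall e,
  perm_eq [seq bname x | x <- orbit (@rotw w) e] (nth [::] code (wname e)).
Hypothesis wname_surj : forall k, k < size code -> exists e, wname e = k.

Let mem_white e n : reflect (exists2 x, fconnect (@rotw w) e x & n = bname x)
  (n \in nth [::] code (wname e)).
Proof.
rewrite -(perm_mem (white_set e)); apply: (iffP mapP) => -[x ex nx]; exists x => //.
  by rewrite fconnect_orbit.
by rewrite -fconnect_orbit.
Qed.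

Let wname_lt e : wname e < size code.
Proof.
rewrite ltnNge; apply/negP => sz.
have := mem_white e (bname e); rewrite nth_default // => h.
by have /h : exists2 x, fconnect (@rotw w) e x & bname e = bname x by exists e.
Qed.

Lemma near_reach n i e : near n i e <-> bname e \in reach code n i.+1.
Proof.
elim: n e => [|n IH] e.
  rewrite /= inE; split=> [->|/eqP]; first by rewrite bname_bnd.
  rewrite -bname_bnd => /esym/bnameP; exact: fconnect_bnd.
rewrite /reach iterS -/(reach code n i.+1) mem_undup; split.
  case=> e1 [e2 [/IH n1 w12 b2]]; apply/flattenP.
  exists (nth [::] code (wname e1)); last by apply/mem_white; exists e2; rewrite //; apply/esym/bnameP.
  rewrite mem_filter mem_nth ?wname_lt // andbT; apply/hasP.
  by exists (bname e1) => //; apply/mem_white; exists e1.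
case/flattenP => c; rewrite mem_filter => /andP[/hasP[m mc mr] cc] ec.
have [k kc cE] : exists2 k, k < size code & c = nth [::] code k.
  by exists (index c code); rewrite ?index_mem ?nth_index.
have [e0 e0k] := wname_surj kc; rewrite cE -e0k in mc ec.
have /mem_white[x ex mx] := mc; have /mem_white[y ey ny] := ec.
exists x, y; split; first by apply/IH; rewrite -mx.
  by apply: connect_trans ey; rewrite (fconnect_sym (@rotw_inj w)).
by apply/bnameP.
Qed.

(** This excludes double edges and squares. *)
Definition simple_code : bool :=
  all uniq code &&
  all (fun k => all (fun j => (j == k) ||
       (count [in nth [::] code j] (nth [::] code k) <= 1)) (iota 0 (size code)))
    (iota 0 (size code)).

Hypothesis simple : simple_code.

Lemma names_inj e e' : wname e = wname e' -> bname e = bname e' -> e = e'.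
Proof.
move=> /wnameP ee' b; have /andP[/allP u _] := simple.
apply: (@eq_on_uniq_map _ _ bname (orbit (@rotw w) e)) b.
- by rewrite (perm_uniq (white_set e)) u // mem_nth.
- by rewrite -fconnect_orbit.
by rewrite -fconnect_orbit.
Qed.

(** A bigon has two edges between the same vertices, and a square two white vertices
    with two common neighbours. *)
Lemma encodes_non_elliptic : #|loop w| = 0 -> non_elliptic w.
Proof.
move=> noloop; apply: (non_elliptic_faces noloop) => e.
rewrite /face => inn; rewrite (turn_inner inn); set f1 := rotb e.
set e2 := rotw f1 => inn2; rewrite (turn_inner inn2); set f2 := rotb e2 => fe.
have bf1 : bname e = bname f1 by apply/bnameP; exact: fconnect1.
have bf2 : bname e2 = bname f2 by apply/bnameP; exact: fconnect1.
have wf1 : wname f1 = wname e2 by apply/wnameP; exact: fconnect1.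
have wf2 : wname f2 = wname e by apply/wnameP; rewrite -fe; exact: fconnect1.
have w12 : wname e <> wname f1.
  by move=> h; have := rotb_neq inn; rewrite -/f1 -(names_inj h bf1) eqxx.
have b12 : bname f1 <> bname e2.
  by move=> h; have := rotw_neq f1; rewrite -/e2 -(names_inj wf1 h) eqxx.
have /andP[_ /allP/(_ (wname e))] := simple.
rewrite mem_iota /= add0n => /(_ (wname_lt _))/allP/(_ (wname f1)).
rewrite mem_iota /= add0n => /(_ (wname_lt _)); case: eqP => [/esym//|_ /=].
rewrite leqNgt => /negP; apply; rewrite -size_filter.
have u : uniq [:: bname f1; bname e2] by rewrite /= inE andbT; apply/eqP.
apply: (uniq_leq_size u) => n; rewrite !inE mem_filter => n12.
have mm (x y : edge w) : wname x = wname y -> bname x \in nth [::] code (wname y).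
  by move=> xy; apply/mem_white; exists x => //; apply/wnameP.
case/orP: n12 => /eqP ->; apply/andP; split.
- exact: mm.
- by rewrite -bf1; exact: mm.
- by apply: mm; rewrite wf1.
by rewrite bf2; exact: mm.
Qed.

End Encodes.

(** A reflection reverses the rotations, which have the same orbits. *)
Lemma disk_image_near mirror g (w w' : web) :
  disk_image mirror g w w' ->
  forall n i j, near n i (bnd w j) <-> near n (g i) (bnd w' (g j)).
Proof.
case=> [fe [fl [fr [[[h hK kK] _ _] [fe_rotw fe_rotb fe_bnd _ _]]]]].
have conn f f' : injective f' -> (forall e, f' (f' (f' e)) = e) ->
   (forall e, if mirror then f' (fe (f e)) = fe e else f' (fe e) = fe (f e)) ->
   forall x y, fconnect f x y -> fconnect f' (fe x) (fe y).
  move=> f'_inj f'3 ff' x y; case/connectP => p + ->.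
  elim: p x => [|z p IH] x /=; first by rewrite connect0.
  case/andP => /eqP <- /IH; apply: connect_trans.
  move: (ff' x); case: (mirror) => {}ff'; last by rewrite -ff' fconnect1.
  by rewrite (fconnect_sym f'_inj) -ff' fconnect1.
have connV f f' : (forall e, f (f (f e)) = e) ->
   (forall e, if mirror then f' (fe (f e)) = fe e else f' (fe e) = fe (f e)) ->
   forall x y, fconnect f' (fe x) (fe y) -> fconnect f x y.
  move=> f3 ff' x y; rewrite -{2}(hK x) -{2}(hK y).
  case/connectP => p + ->.
  elim: p (fe x) => [|z p IH] u /=; first by rewrite connect0.
  case/andP => /eqP <- /IH; apply: connect_trans.
  have := ff' (if mirror then f (f (h u)) else h u); case: (mirror) => E.
    rewrite f3 kK in E; rewrite E hK.
    exact: connect_trans (fconnect1 _ _) (fconnect1 _ _).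
  by rewrite kK in E; rewrite E hK fconnect1.
have connE f f' : injective f' -> (forall e, f (f (f e)) = e) ->
    (forall e, f' (f' (f' e)) = e) ->
   (forall e, if mirror then f' (fe (f e)) = fe e else f' (fe e) = fe (f e)) ->
   forall x y, fconnect f x y <-> fconnect f' (fe x) (fe y).
  by move=> f'_inj f3 f'3 ff' x y; split; [exact: conn | exact: connV].
have wE := connE _ _ (@rotw_inj w') (@rotw3 w) (@rotw3 w') fe_rotw.
have bE := connE _ _ (@rotb_inj w') (@rotb3 w) (@rotb3 w') fe_rotb.
have key n i e : near n i e <-> near n (g i) (fe e).
  elim: n e => [|n IH] e /=.
    rewrite fe_bnd; split=> [->//|/(congr1 h)]; by rewrite !hK.
  split=> [[e1 [e2 [/IH n1 /wE w12 /bE b2]]]|[e1 [e2 [n1 w12 b2]]]].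
    by exists (fe e1), (fe e2).
  rewrite -(kK e1) -(kK e2) in n1 w12 b2.
  exists (h e1), (h e2); split; [exact/IH | exact/wE | exact/bE].
by move=> n i j; rewrite fe_bnd; exact: key.
Qed.

(** * Webs given by tables *)

Lemma fcard_transversal (T : finType) (f h : T -> T) : injective f ->
  (forall x, fconnect f x (h x)) -> (forall x, h (f x) = h x) ->
  fcard f T = #|[pred x | h x == x]|.
Proof.
move=> f_inj fh hf.
have hE x y : fconnect f x y -> h x = h y.
  case/connectP => p + ->; elim: p x => [|z p IH] x //= /andP[/eqP <- /IH <-].
  by rewrite hf.
pose X : {pred T} := froots f.
have -> : fcard f T = #|X| by apply: eq_card => x; rewrite !inE andbT.
have inj : {in X &, injective h}.
  move=> x y /eqP <- /eqP <- hxy; apply/eqP; rewrite root_connect; last exact: fconnect_sym.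
  have rx := connect_root (frel f) x; have ry := connect_root (frel f) y.
  rewrite -(hE _ _ rx) -(hE _ _ ry) in hxy; apply: connect_trans (fh x) _.
  by rewrite hxy fconnect_sym.
rewrite -(card_in_image inj); apply: eq_card => x; rewrite [RHS]inE.
apply/imageP/eqP => [[y _ ->]|hx]; first by rewrite -(hE _ _ (fh y)).
exists (froot f x); first exact: roots_root (fconnect_sym f_inj) _.
by rewrite -(hE _ _ (connect_root _ x)).
Qed.

(** Permutations of an initial segment of nat, in a form that computes: an orbit is
    known by its least element. *)
Section FinitePermutation.
Variables (n : nat) (f : nat -> nat).
Let N := n.+1.

Definition rep (x : nat) : nat := foldr minn x (traject f x N).

Definition perm_ok : bool :=
  uniq (map f (iota 0 N)) &&
  all (fun x => [&& f x < N, rep (f x) == rep x, rep x < N & rep x \in traject f x N])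
    (iota 0 N).

Definition orbit_count : nat := count (fun x => rep x == x) (iota 0 N).

Hypothesis ok : perm_ok.
Definition lift_perm (x : 'I_N) : 'I_N := inord (f x).

Lemma perm_okP (x : 'I_N) : [/\ f x < N, rep (f x) = rep x, rep x < N & rep x \in traject f x N].
Proof.
by have /andP[_ /allP/(_ (x : nat))] := ok; rewrite mem_iota ltn_ord => /(_ isT)/and4P[? /eqP].
Qed.

Lemma lift_permE x : lift_perm x = f x :> nat.
Proof. by rewrite inordK; case: (perm_okP x). Qed.

Let lift_iter k x : iter k lift_perm x = iter k f x :> nat.
Proof. by elim: k => //= k <-; rewrite lift_permE. Qed.

Let lift_rep x : fconnect lift_perm x (inord (rep x)).
Proof.
have [_ _ rx /trajectP[k _ rk]] := perm_okP x.
have -> : inord (rep x) = iter k lift_perm x.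
  by apply: val_inj; rewrite /= inordK // lift_iter.
exact: fconnect_iter.
Qed.

Lemma lift_perm_inj : injective lift_perm.
Proof.
move=> x y /(congr1 val); rewrite /= !lift_permE => fxy; apply: val_inj.
have /andP[u _] := ok; apply: (eq_on_uniq_map u _ _ fxy).
  by rewrite mem_iota ltn_ord.
by rewrite mem_iota ltn_ord.
Qed.
Let inj := lift_perm_inj.

Lemma rep_fconnect x y : fconnect lift_perm x y = (rep x == rep y).
Proof.
apply/idP/eqP.
  case/connectP => p + ->; elim: p x => [|z p IH] x //= /andP[/eqP <- /IH <-].
  by rewrite lift_permE; case: (perm_okP x).
move=> xy; apply: connect_trans (lift_rep x) _.
by rewrite xy fconnect_sym.
Qed.

Lemma rep_idem (x : 'I_N) : rep (rep x) = rep x.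
Proof.
have [_ _ rx _] := perm_okP x; have := lift_rep x.
by rewrite rep_fconnect inordK // => /eqP.
Qed.

Lemma fcard_lift : fcard lift_perm 'I_N = orbit_count.
Proof.
pose h (x : 'I_N) : 'I_N := inord (rep x).
rewrite (@fcard_transversal _ _ h inj) //; last first.
  by move=> x; rewrite /h lift_permE; case: (perm_okP x) => _ ->.
rewrite /orbit_count -val_enum_ord count_map cardE /enum_mem size_filter -enumT.
rewrite [X in _ = count _ X](_ : _ = enum 'I_N); last exact/all_filterP/allP.
apply: eq_count => x /=; apply/eqP/eqP => [hx|rx].
  by rewrite -[RHS](congr1 val hx) /h /= inordK //; case: (perm_okP x).
by apply: val_inj; rewrite /h /= inordK rx.
Qed.

End FinitePermutation.

(** A map on the edges 0, ..., size - 1: the rotations around the white and the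
    black vertices, and the edges at the boundary vertices. *)
Record table := Table { nedges : nat; twhite : seq nat; tblack : seq nat; tbnd : seq nat }.

Section TableWeb.
Variable T : table.

Definition tab_rotw e := nth e (twhite T) e.
Definition tab_rotb e := nth e (tblack T) e.
Definition tab_turn e :=
  if e \in tbnd T then nth 0 (tbnd T) ((index e (tbnd T) + 11) %% 12) else tab_rotb e.
Definition tab_face e := tab_rotw (tab_turn e).
Let n := (nedges T).-1.

Definition tab_left e :=
  index (rep n tab_face e) [seq r <- iota 0 n.+1 | rep n tab_face r == r].

(** Each edge in this list is linked to the circle, whatever k is. *)
Definition tab_span (k : nat) : seq nat :=
  iter k (fun s => undup (s ++ map tab_rotw s ++ map tab_turn s))
    (tbnd T).

Definition table_ok : bool :=
  [&& perm_ok n tab_rotw, perm_ok n tab_rotb, perm_ok n tab_turn, perm_ok n tab_face &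
   [&& all (fun e => let f := tab_rotw in (f (f (f e)) == e) && (f e != e)) (iota 0 n.+1),
       all (fun e => let f := tab_rotb in (f (f (f e)) == e) &&
         ((f e == e) == (e \in tbnd T))) (iota 0 n.+1),
       [&& size (tbnd T) == 12, uniq (tbnd T) & all (fun e => e < n.+1) (tbnd T)],
       all [in tab_span 6] (iota 0 n.+1) &
       (orbit_count n tab_rotw + orbit_count n tab_turn + orbit_count n tab_face == n.+3)
       && ((size (twhite T) == n.+1) && (size (tblack T) == n.+1))]].

Hypothesis ok : table_ok.

Let rw_ok : perm_ok n tab_rotw. Proof. by case/and5P: ok. Qed.
Let rb_ok : perm_ok n tab_rotb. Proof. by case/and5P: ok. Qed.
Let turn_ok : perm_ok n tab_turn. Proof. by case/and5P: ok. Qed.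
Let face_ok : perm_ok n tab_face. Proof. by case/and5P: ok. Qed.

Let faces := [seq r <- iota 0 n.+1 | rep n tab_face r == r].

Definition table_diagram : diagram :=
  @Diagram 'I_n.+1 void 'I_(size faces).-1.+1
    (lift_perm tab_rotw) (lift_perm tab_rotb)
    (fun i : 'I_12 => inord (nth 0 (tbnd T) i))
    (fun e => inord (tab_left e)) (fun l => match l with end).

Let D := table_diagram.

Let bndE (i : 'I_12) : bnd D i = nth 0 (tbnd T) i :> nat.
Proof.
have /and5P[_ _ _ _ /and5P[_ _ /and3P[/eqP sz _ /allP lt] _ _]] := ok.
by rewrite inordK // lt // mem_nth ?sz.
Qed.

Let rotwE (e : edge D) : rotw e = tab_rotw e :> nat.
Proof. exact: lift_permE. Qed.

Let rotbE (e : edge D) : rotb e = tab_rotb e :> nat.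
Proof. exact: lift_permE. Qed.

Let mem_bnd (e : edge D) : (e \in codom (@bnd D)) = (val e \in tbnd T).
Proof.
have /and5P[_ _ _ _ /and5P[_ _ /and3P[/eqP sz _ _] _ _]] := ok.
apply/codomP/idP => [[i ->]|eb]; first by rewrite (bndE i : val _ = _) mem_nth ?sz.
have ie : index (val e) (tbnd T) < 12 by rewrite -sz index_mem.
by exists (Ordinal ie); apply: ord_inj; rewrite bndE nth_index.
Qed.

Let in_iota (e : edge D) : val e \in iota 0 n.+1.
Proof. by rewrite mem_iota ltn_ord. Qed.

Let bnd_inj' : injective (@bnd D).
Proof.
have /and5P[_ _ _ _ /and5P[_ _ /and3P[/eqP sz u _] _ _]] := ok.
move=> i j /(congr1 (@nat_of_ord _)); rewrite !bndE => /eqP.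
by rewrite nth_uniq ?sz // => /eqP/val_inj.
Qed.

Let rotw_inj' : injective (@rotw D) := lift_perm_inj rw_ok.
Let rotb_inj' : injective (@rotb D) := lift_perm_inj rb_ok.

Let white_degree' (e : edge D) : order (@rotw D) e = 3.
Proof.
have /and5P[_ _ _ _ /and5P[/allP/(_ _ (in_iota e))/andP[/eqP f3 f1] _ _ _ _]] := ok.
apply: order_eq3; first by apply: ord_inj; rewrite !rotwE.
by rewrite -(inj_eq (@ord_inj _)) rotwE.
Qed.

Let black_degree' (e : edge D) :
  order (@rotb D) e = if e \in codom (@bnd D) then 1 else 3.
Proof.
have /and5P[_ _ _ _ /and5P[_ /allP/(_ _ (in_iota e))/andP[/eqP f3 /eqP f1] _ _ _]] := ok.
rewrite mem_bnd -f1; case: eqP => fe.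
  have cyc : fcycle (@rotb D) [:: e] by rewrite /= -(inj_eq (@ord_inj _)) rotbE fe eqxx.
  by apply: (order_cycle cyc); rewrite ?inE.
apply: order_eq3; first by apply: ord_inj; rewrite !rotbE.
by rewrite -(inj_eq (@ord_inj _)) rotbE; apply/eqP.
Qed.

Let turnE : @turn D =1 lift_perm tab_turn.
Proof.
have /and5P[_ _ _ _ /and5P[_ _ /and3P[/eqP sz u _] _ _]] := ok.
move=> e; apply: ord_inj; rewrite lift_permE // /turn /tab_turn -mem_bnd.
case: pickP => [i /eqP <-|none].
  rewrite codom_f !bndE; congr nth; rewrite index_uniq ?sz //=; lia.
case: ifP => [/codomP[i eE]|_]; last exact: rotbE.
by have := none i; rewrite eE eqxx.
Qed.

Let faceE : @face D =1 lift_perm tab_face.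
Proof.
move=> e; apply: ord_inj; rewrite lift_permE // /face rotwE.
by rewrite turnE lift_permE.
Qed.

Let rep_face (e : edge D) : rep n tab_face e \in faces.
Proof.
have [_ _ re _] := perm_okP face_ok e.
by rewrite mem_filter (rep_idem face_ok) eqxx mem_iota.
Qed.

Let faces_gt0 : 0 < size faces.
Proof. by case: faces (rep_face ord0). Qed.

Let left_ofE (e : edge D) : left_of e = tab_left e :> nat.
Proof. by rewrite /= inordK // prednK // index_mem rep_face. Qed.

Let left_of_face' (e : edge D) : left_of (face e) = left_of e.
Proof.
apply: ord_inj; rewrite !left_ofE /tab_left; congr index.
by apply/esym/eqP; rewrite -(rep_fconnect face_ok) -(eq_fconnect faceE) fconnect1.
Qed.

Let tab_linked (e : edge D) : connect (@linked D) (bnd D ord0) e.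
Proof.
have /and5P[_ _ _ _ /and5P[_ _ _ /allP/(_ _ (in_iota e)) + _]] := ok.
have span k m : m \in tab_span k ->
    exists2 x : edge D, m = x :> nat & connect (@linked D) (bnd D ord0) x.
  elim: k m => [|k IH] m /=.
    move=> mb; have [_ _ _ _ /and5P[_ _ /and3P[/eqP sz _ _] _ _]] := and5P ok.
    have im : index m (tbnd T) < 12 by rewrite -sz index_mem.
    exists (bnd D (Ordinal im)); last exact: (@circle_linked D bnd_inj' ord0 (Ordinal im)).
    by rewrite bndE nth_index.
  rewrite mem_undup !mem_cat => /or3P[|/mapP[x /IH[y -> by'] ->]|/mapP[x /IH[y -> by'] ->]].
  - exact: IH.
  - exists (rotw y); first by rewrite rotwE.
    by apply: connect_trans by' (connect1 _); apply/orP; left.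
  exists (turn y); first by rewrite turnE lift_permE.
  by apply: connect_trans by' (connect1 _); apply/orP; right.
by case/span => x /ord_inj ->.
Qed.

Let linked_sym : connect_sym (@linked D).
Proof.
apply: linked_symmetric rotw_inj' _ => x y; rewrite !turnE.
exact: (lift_perm_inj turn_ok).
Qed.

Let connect_all (e e' : edge D) : connect (@linked D) e e'.
Proof. by apply: connect_trans (tab_linked e'); rewrite linked_sym tab_linked. Qed.

Let n_comp1 : n_comp (@linked D) (edge D) = 1.
Proof.
rewrite -(n_comp_connect linked_sym (bnd D ord0)).
by apply: eq_card => e; rewrite !inE connect_all.
Qed.

Let fcard_face : fcard (@face D) (edge D) = size faces.
Proof. by rewrite (eq_fcard faceE) fcard_lift // size_filter. Qed.

Let component_planar' (e : edge D) :
  let C := connect (@linked D) e in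
  fcard (@rotw D) C + fcard (@turn D) C + fcard (@face D) C = #|C| + 2.
Proof.
move=> C.
have fcT f : fcard f C = fcard f (edge D).
  by apply: eq_card => x; rewrite !inE /C connect_all.
have -> : #|C| = n.+1.
  by rewrite -[RHS]card_ord; apply: eq_card => x; rewrite [LHS]connect_all.
have /and5P[_ _ _ _ /and5P[_ _ _ _ /andP[/eqP euler _]]] := ok.
rewrite !fcT fcard_face size_filter (eq_fcard turnE) !fcard_lift //.
by rewrite -/(orbit_count n tab_face) euler addn2.
Qed.

Let regions_connected' (r s : region D) : connect (@adjacent D) r s.
Proof.
have rep r' : exists e, @left_of D e = r'.
  have lt : nth 0 faces r' < n.+1.
    have : nth 0 faces r' \in faces by rewrite mem_nth // -{2}(prednK faces_gt0).
    by rewrite mem_filter mem_iota => /andP[].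
  exists (inord (nth 0 faces r')); apply: ord_inj.
  rewrite left_ofE /tab_left inordK // -/faces.
  have : nth 0 faces r' \in faces by rewrite mem_nth // -{2}(prednK faces_gt0).
  rewrite mem_filter => /andP[/eqP-> _]; rewrite index_uniq ?filter_uniq ?iota_uniq //.
  by rewrite -{2}(prednK faces_gt0).
have adj (e : edge D) : adjacent (left_of e) (right_of e).
  by apply/orP; left; apply/existsP; exists e.
have adjV (e : edge D) : adjacent (right_of e) (left_of e).
  by apply/orP; left; apply/existsP; exists e; rewrite setUC.
have [e <-] := rep r; have [e' <-] := rep s.
case/connectP: (connect_all e e') => p + ->.
elim: p e => [|x p IH] e; first by rewrite connect0.
rewrite [path _ _ _]/= [last _ _]/=.
case/andP => /orP[]/eqP <- /IH; apply: connect_trans.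
  exact: connect1 (adj e).
by rewrite -left_of_face'; exact: connect1 (adjV (turn e)).
Qed.

Let card_loop_sides' (l : loop D) : #|loop_sides l| = 2.
Proof. by case: l. Qed.

Let regions_tree' :
  n_comp (@linked D) (edge D) + #|loop D| + #|region D|
  = fcard (@face D) (edge D) + 2 * #|loop D| + 1.
Proof.
rewrite n_comp1 fcard_face card_ord prednK // (card_void : #|loop D| = 0); lia.
Qed.

Definition table_web : web :=
  Web rotw_inj' rotb_inj' bnd_inj' white_degree' black_degree' card_loop_sides'
    left_of_face' component_planar' regions_connected' regions_tree'.

End TableWeb.

Section TableWebTheory.
Variables (T : table) (ok : table_ok T).

Lemma table_rotw (e : edge (table_web ok)) : rotw e = tab_rotw T e :> nat.
Proof. by apply: lift_permE; case/and5P: ok. Qed.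

Lemma table_rotb (e : edge (table_web ok)) : rotb e = tab_rotb T e :> nat.
Proof. by apply: lift_permE; case/and5P: ok. Qed.

Lemma table_bnd i : bnd (table_web ok) i = nth 0 (tbnd T) i :> nat.
Proof.
have /and5P[_ _ _ _ /and5P[_ _ /and3P[/eqP sz _ /allP lt] _ _]] := ok.
by rewrite inordK // lt // mem_nth ?sz.
Qed.

Lemma tab_rotw_out e : nedges T <= e -> 0 < nedges T -> tab_rotw T e = e.
Proof.
move=> le n0; have /and5P[_ _ _ _ /and5P[_ _ _ _ /and3P[_ /eqP sz _]]] := ok.
by rewrite /tab_rotw nth_default // sz prednK.
Qed.

Lemma tab_rotb_out e : nedges T <= e -> 0 < nedges T -> tab_rotb T e = e.
Proof.
move=> le n0; have /and5P[_ _ _ _ /and5P[_ _ _ _ /and3P[_ _ /eqP sz]]] := ok.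
by rewrite /tab_rotb nth_default // sz prednK.
Qed.

Lemma table_fconnect_rotw (e e' : edge (table_web ok)) :
  fconnect (@rotw _) e e' =
  (rep (nedges T).-1 (tab_rotw T) e == rep (nedges T).-1 (tab_rotw T) e').
Proof. by apply: rep_fconnect; case/and5P: ok. Qed.

Lemma table_fconnect_rotb (e e' : edge (table_web ok)) :
  fconnect (@rotb _) e e' =
  (rep (nedges T).-1 (tab_rotb T) e == rep (nedges T).-1 (tab_rotb T) e').
Proof. by apply: rep_fconnect; case/and5P: ok. Qed.

(** The edges are numbered in the order of the names in the code, three for each
    white vertex. *)
Variable code : seq (seq nat).
Let flat := flatten code.
Let N := (nedges T).-1.+1.

Definition code_ok : bool :=
  [&& all (fun e => all (fun e' =>
         ((e %/ 3 == e' %/ 3) == (rep N.-1 (tab_rotw T) e == rep N.-1 (tab_rotw T) e')) &&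
         ((nth 0 flat e == nth 0 flat e') ==
          (rep N.-1 (tab_rotb T) e == rep N.-1 (tab_rotb T) e'))) (iota 0 N)) (iota 0 N),
      all (fun i => nth 0 flat (nth 0 (tbnd T) i) == i.+1) (iota 0 12),
      all (fun e => perm_eq [seq nth 0 flat x | x <- traject (tab_rotw T) e 3]
                            (nth [::] code (e %/ 3))) (iota 0 N)
    & all (fun k => 3 * k < N) (iota 0 (size code))].

Lemma table_encodes : code_ok -> encodes code (table_web ok).
Proof.
case/and4P => /allP names /allP circ /allP white /allP pos.
split; first exact: card_void.
have iN (e : edge (table_web ok)) : nat_of_ord e \in iota 0 N by rewrite mem_iota ltn_ord.
exists (fun e => nat_of_ord e %/ 3), (fun e => nth 0 flat (nat_of_ord e)); split.
- move=> e e'; have /allP/(_ _ (iN e'))/andP[/eqP h _] := names _ (iN e).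
  by rewrite table_fconnect_rotw -h; split=> /eqP.
- move=> e e'; have /allP/(_ _ (iN e'))/andP[_ /eqP h] := names _ (iN e).
  by rewrite table_fconnect_rotb -h; split=> /eqP.
- by move=> i; rewrite table_bnd; apply/eqP/circ; rewrite mem_iota /=.
- move=> e; have := white _ (iN e); rewrite /orbit white_degree /= !table_rotw.
  exact.
move=> k; have := pos k; rewrite mem_iota /= => lt /lt {}lt.
by exists (inord (3 * k)); rewrite inordK // mulKn.
Qed.

End TableWebTheory.

(** * The webs W_1, ..., W_32 and their images *)

Lemma corners_inj : injective corners.
Proof. by case=> [] []. Qed.

HB.instance Definition _ := Equality.copy piece (inj_type corners_inj).

(** The orientations of the drawings of W_1, ..., W_32: the positions of the sets
    whose items are listed counterclockwise around the white vertex, and the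
    letters whose three edges are listed counterclockwise. *)
Definition W_orientations : seq (seq nat * seq nat) :=
  [:: ([:: 1; 4; 7], [::]);
     ([:: 4; 6], [:: 13; 15]);
     ([:: 6; 7], [:: 13; 14; 15]);
     ([:: 4; 7], [:: 13; 15]);
     ([:: 4; 5; 6], [:: 14; 15; 16]);
     ([::], [::]);
     ([:: 5], [::]);
     ([:: 5], [::]);
     ([:: 5; 6], [:: 15]);
     ([:: 3; 4; 6], [:: 14]);
     ([:: 4; 5], [:: 14; 15]);
     ([::], [::]);
     ([:: 2], [::]);
     ([:: 2; 5], [::]);
     ([:: 5], [::]);
     ([:: 4; 5], [:: 14]);
     ([:: 5], [:: 14]);
     ([::], [::]);
     ([:: 4; 5], [:: 14]);
     ([::], [::]);
     ([:: 4], [::]);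
     ([::], [::]);
     ([:: 4], [::]);
     ([:: 4], [::]);
     ([::], [::]);
     ([:: 4], [::]);
     ([::], [::]);
     ([::], [::]);
     ([::], [::]);
     ([::], [::]);
     ([::], [::]);
     ([::], [::])].

(** The edge number 3 k + i goes to the i-th name in the k-th set; rotations follow
    the order of the code, or the opposite one where the orientation says so. *)
Definition oriented_table (code : seq (seq nat)) (o : seq nat * seq nat) : table :=
  let names := flatten code in
  let edges := iota 0 (size names) in
  Table (size names)
    [seq 3 * (e %/ 3) + (e + (if e %/ 3 \in o.1 then 2 else 1)) %% 3 | e <- edges]
    [seq let m := nth 0 names e in
         let s := [seq x <- edges | nth 0 names x == m] in
         next (if m \in o.2 then rev s else s) e | e <- edges]
    [seq index i names | i <- iota 1 12].

Definition W_tables : seq table :=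
  [seq oriented_table x.1 x.2 | x <- zip W_codes W_orientations].

Definition W_table (k : nat) : table :=
  nth (Table 0 [::] [::] [::]) W_tables k.

Lemma W_tables_ok : all table_ok W_tables.
Proof. by vm_compute. Qed.

Lemma W_codes_ok : all (fun x => code_ok x.1 x.2) (zip W_tables W_codes) &&
  all simple_code W_codes.
Proof. by vm_compute. Qed.

(** The mirror image has the inverse rotations; they are squares, as the orders are
    1 and 3. *)
Definition image_rotw (T : table) (mirror : bool) e :=
  if mirror then tab_rotw T (tab_rotw T e) else tab_rotw T e.
Definition image_rotb (T : table) (mirror : bool) e :=
  if mirror then tab_rotb T (tab_rotb T e) else tab_rotb T e.
(** The inverse of dihedral mirror r. *)
Definition unshift (mirror : bool) r j : nat :=
  let i := (j + r) %% 12 in if mirror then 11 - i else i.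

Definition image_bnd (T : table) (mirror : bool) r : seq nat :=
  [seq nth 0 (tbnd T) (unshift mirror r j) | j <- iota 0 12].

(** This only has to guess the word, which is then run. *)
Fixpoint peel_leftmost (D : eqType) (rot flip : D -> D) fuel l r : seq (option piece) :=
  if (fuel, r) is (n.+1, a :: b :: r') then
    let peel t := Some t :: peel_leftmost rot flip n (behead l)
                              (step_back l (joins_by rot flip t a b ++ r')) in
    if fits_by rot flip Arc a b then peel Arc
    else if fits_by rot flip Fork a b then peel Fork
    else if fits_by rot flip Bridge a b then peel Bridge
    else None :: peel_leftmost rot flip n (a :: l) (b :: r')
  else [::].

Definition image_word T mirror r : seq (option piece) :=
  peel_leftmost (dart_rot (image_rotw T mirror) (image_rotb T mirror)) (@dart_flip _)
    100 [::] [seq (e, false) | e <- image_bnd T mirror r].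

Definition image_runs T mirror r m : bool :=
  runs (dart_rot (image_rotw T mirror) (image_rotb T mirror)) (@dart_flip _)
    [::] [seq (e, false) | e <- image_bnd T mirror r] m.

Definition motions : seq (bool * nat) :=
  [seq (mirror, r) | mirror <- [:: false; true], r <- iota 0 12].

Definition W_words : seq (seq (option piece)) :=
  [seq image_word (W_table k) g.1 g.2 | k <- iota 0 32, g <- motions].

Definition near_matrix code (n : nat) : seq (seq bool) :=
  [seq [seq j.+1 \in reach code n i.+1 | j <- iota 0 12] | i <- iota 0 12].

Definition image_matrix (x : seq (seq bool)) mirror r : seq (seq bool) :=
  [seq [seq nth false (nth [::] x (unshift mirror r i)) (unshift mirror r j)
       | j <- iota 0 12] | i <- iota 0 12].

(** If an image of W_j has the same pairs of near labels as W_k, for one and for two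
    white vertices, then j = k and the image is isotopic to W_k, having the same word.
    The words and the relations are abstract here, so that using this property does
    not compute them. *)
Definition separated (U : eqType) (word : nat -> bool -> nat -> U)
  (near1 near2 : seq (seq (seq bool))) : bool :=
  all (fun j => all (fun g =>
    let x1 := image_matrix (nth [::] near1 j) g.1 g.2 in
    let x2 := image_matrix (nth [::] near2 j) g.1 g.2 in
    all (fun k => if (x1 == nth [::] near1 k) && (x2 == nth [::] near2 k)
      then (j == k) && (word j g.1 g.2 == word k false 0)
      else true) (iota 0 32)) motions) (iota 0 32).

Lemma W_separated :
  separated (fun j => image_word (W_table j))
    [seq near_matrix c 1 | c <- W_codes] [seq near_matrix c 2 | c <- W_codes].
Proof. by vm_compute. Qed.

(** The bound 100 on the number of steps of the search is not reached. *)
Lemma W_words_survey : let ws := undup W_words in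
  survey (fun m => m \in ws) 100 false [::] (nseq 12 (false, 6)) [::].
Proof. by vm_compute. Qed.

Lemma W_words_run : all (fun T => all (fun g =>
    let m := image_word T g.1 g.2 in
    image_runs T g.1 g.2 m && (word_weight m == nedges T)) motions) W_tables.
Proof. by vm_compute. Qed.

Lemma mem_motions mirror r : r < 12 -> (mirror, r) \in motions.
Proof. by move=> r12; apply: allpairs_f; rewrite ?mem_iota // !inE; case: mirror. Qed.

Lemma separatedP (U : eqType) (word : nat -> bool -> nat -> U) near1 near2
    (j k : 'I_32) mirror r :
  separated word near1 near2 -> r < 12 ->
  image_matrix (nth [::] near1 j) mirror r = nth [::] near1 k ->
  image_matrix (nth [::] near2 j) mirror r = nth [::] near2 k ->
  j = k /\ word j mirror r = word k false 0.
Proof.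
move=> /allP/(_ (val j)); rewrite mem_iota ltn_ord => /(_ isT)/allP sep r12 e1 e2.
have /allP/(_ (val k)) := sep _ (mem_motions mirror r12).
rewrite mem_iota ltn_ord => /(_ isT); rewrite e1 e2 !eqxx.
by case/andP => /eqP/ord_inj -> /eqP.
Qed.

(** * Classification *)

Lemma dihedral_unshift mirror r (i : 'I_12) :
  unshift mirror r (dihedral mirror r i) = i :> nat.
Proof.
rewrite /unshift /dihedral.
have -> : forall j, iter r (@ord_pred 12) j = (j + 11 * r) %% 12 :> nat.
  move=> j; elim: r => [|n IH] /=; first by rewrite muln0 addn0 modn_small.
  by rewrite IH; lia.
by case: mirror; move: (ltn_ord i) => /=; lia.
Qed.

Lemma unshift_lt mirror r j : unshift mirror r j < 12.
Proof. by rewrite /unshift; case: mirror; lia. Qed.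

Lemma linked_ind (w : web) (P : edge w -> Prop) :
  (forall e, connect (@linked w) (bnd w ord0) e) ->
  (forall i, P (bnd w i)) -> (forall e, P e -> P (rotw e)) ->
  (forall e, P e -> P (rotb e)) -> forall e, P e.
Proof.
move=> lk Pc Pw Pb e; have /connectP[p + ->] := lk e.
elim: p (bnd w ord0) (Pc ord0) => [|x p IH] e' Pe' //= /andP[/orP[]/eqP <-]; apply: IH.
  exact: Pw.
case inn: (inner e'); first by rewrite turn_inner //; exact: Pb.
by move/negbFE: inn => /codomP[i ->]; rewrite turn_bnd.
Qed.

Section ImageDisk.
Variables (T : table) (ok : table_ok T) (w : web) (mirror : bool) (r : nat).
Hypothesis table_nonell : non_elliptic (table_web ok).
Hypothesis nonell : non_elliptic w.

Let W := table_web ok.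
Let g := dihedral mirror r.

Hypothesis T_gt0 : 0 < nedges T.

Let tab3 (f : nat -> nat) (fW : edge W -> edge W) :
  (forall e : edge W, fW e = f e :> nat) -> (forall e, fW (fW (fW e)) = e) ->
  (forall e : nat, nedges T <= e -> 0 < nedges T -> f e = e) ->
  forall e, f (f (f e)) = e.
Proof.
move=> fE f3 out e; have [lt|ge] := ltnP e (nedges T).-1.+1; last first.
  by rewrite !out // -(prednK T_gt0).
by have := congr1 (@nat_of_ord _) (f3 (Ordinal lt)); rewrite !fE.
Qed.

Let tw3 : forall e, tab_rotw T (tab_rotw T (tab_rotw T e)) = e :=
  tab3 (@table_rotw T ok) (@rotw3 W) (@tab_rotw_out T ok).
Let tb3 : forall e, tab_rotb T (tab_rotb T (tab_rotb T e)) = e :=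
  tab3 (@table_rotb T ok) (@rotb3 W) (@tab_rotb_out T ok).

Let image_bndE (i : 'I_12) : nth 0 (image_bnd T mirror r) (g i) = bnd W i.
Proof.
by rewrite (nth_map 0) ?size_iota ?ltn_ord // nth_iota ?ltn_ord // dihedral_unshift table_bnd.
Qed.

(** The word gives a map of the edges of w to those of the table.  It is onto, since all
    edges are linked to the circle, and bijective, since the word determines the number
    of edges. *)
Lemma disk_image_of_word m : word_collapses w m -> image_runs T mirror r m ->
  word_weight m = nedges T -> disk_image mirror g W w.
Proof.
move=> wm runm wt.
have fix_bnd e : e \in image_bnd T mirror r -> image_rotb T mirror e = e.
  case/mapP => j _ ->; set i := unshift _ _ _.
  have -> : nth 0 (tbnd T) i = bnd W (Ordinal (unshift_lt mirror r j)).
    by rewrite table_bnd.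
  have fixb i' : tab_rotb T (bnd W i') = bnd W i' by rewrite -(@table_rotb T ok) rotb_bnd.
  by rewrite /image_rotb; case: mirror; rewrite !fixb.
have [] := word_transfer 0 wm _ _ runm _ fix_bnd.
- by move=> e; rewrite /image_rotw; case: mirror; rewrite ?tw3 // tw3.
- by move=> e; rewrite /image_rotb; case: mirror; rewrite ?tb3 // tb3.
- by rewrite size_map size_iota.
move=> card [f [fw fb fbd]].
have w_linked := non_elliptic_linked nonell.
have W_linked := non_elliptic_linked table_nonell.
have g_bij : bijective g := dihedral_bij mirror r.
have [g' gK g'K] := g_bij.
have f_bnd i : f (bnd w (g i)) = bnd W i by rewrite fbd image_bndE.
pose iw (x : edge W) := if mirror then rotw (rotw x) else rotw x.
pose ib (x : edge W) := if mirror then rotb (rotb x) else rotb x.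
have iwE x : iw x = image_rotw T mirror x :> nat.
  by rewrite /iw /image_rotw; case: mirror; rewrite !table_rotw.
have ibE x : ib x = image_rotb T mirror x :> nat.
  by rewrite /ib /image_rotb; case: mirror; rewrite !table_rotb.
have f_edge e : exists x : edge W, f e = x :> nat.
  move: e; apply: (linked_ind w_linked) => [j|e [x fx]|e [x fx]].
  - by exists (bnd W (g' j)); rewrite -{1}(g'K j) f_bnd.
  - by exists (iw x); rewrite fw iwE fx.
  by exists (ib x); rewrite fb ibE fx.
pose h e : edge W := inord (f e).
have hE e : h e = f e :> nat by have [x fx] := f_edge e; rewrite /h fx inord_val.
have hw e : h (rotw e) = iw (h e) by apply: ord_inj; rewrite iwE !hE fw.
have hb e : h (rotb e) = ib (h e) by apply: ord_inj; rewrite ibE !hE fb.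
have h_bnd i : h (bnd w (g i)) = bnd W i by apply: ord_inj; rewrite hE f_bnd.
have h_surj x : exists e, h e == x.
  move: x; apply: (linked_ind W_linked) => [i|x [e /eqP <-]|x [e /eqP <-]].
  - by exists (bnd w (g i)); rewrite h_bnd.
  - exists (if mirror then rotw (rotw e) else rotw e).
    by rewrite /iw in hw *; case: mirror hw => hw; rewrite !hw // rotw3.
  exists (if mirror then rotb (rotb e) else rotb e).
  by rewrite /ib in hb *; case: mirror hb => hb; rewrite !hb // rotb3.
pose fe x := xchoose (h_surj x).
have feK : cancel fe h by move=> x; exact/eqP/(xchooseP (h_surj x)).
have fe_bij : bijective fe.
  apply: inj_card_bij; first exact: can_inj feK.
  by rewrite card wt (card_ord _ : #|edge W| = (nedges T).-1.+1) prednK.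
have h_inj : injective h.
  have [k feKk kK] := fe_bij; move=> x y; rewrite -(kK x) -(kK y) !feK.
  by move->.
apply: (disk_image_of_edges _ _ W_linked w_linked fe_bij) => //.
- exact: card_void.
- by case: nonell.
- move=> x; have := hw; rewrite /iw; case: mirror => hw'; apply: h_inj.
    by rewrite hw' !feK rotw3.
  by rewrite hw' !feK.
- move=> x; have := hb; rewrite /ib; case: mirror => hb'; apply: h_inj.
    by rewrite hb' !feK rotb3.
  by rewrite hb' !feK.
- by move=> i; apply: h_inj; rewrite h_bnd feK.
exact: dihedral_pred.
Qed.

End ImageDisk.

Lemma size_tables : size W_tables = 32. Proof. by rewrite size_map size_zip. Qed.

Lemma W_table_ok (k : 'I_32) : table_ok (W_table k).
Proof.
have /(all_nthP (Table 0 [::] [::] [::])) := W_tables_ok; apply.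
by rewrite size_tables.
Qed.

Definition W_web (k : 'I_32) : web := table_web (W_table_ok k).

Lemma W_encodes (k : 'I_32) : encodes (W_code k) (W_web k).
Proof.
apply: table_encodes; have /andP[/(all_nthP (Table 0 [::] [::] [::], [::])) + _] := W_codes_ok.
move=> /(_ k); rewrite size_zip size_tables nth_zip ?size_tables //.
by move=> /(_ (ltn_ord k)).
Qed.

Lemma encodes_W_non_elliptic (k : 'I_32) w : encodes (W_code k) w -> non_elliptic w.
Proof.
have sk : simple_code (W_code k).
  have /andP[_ /(all_nthP [::]) h] := W_codes_ok; exact: (h k).
move=> [noloop [wname [bname [wP bP bb ws wsurj]]]].
exact: (encodes_non_elliptic wP bP ws sk noloop).
Qed.

Lemma near_code (k : 'I_32) w n (i j : 'I_12) : encodes (W_code k) w ->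
  near n i (bnd w j) <-> j.+1 \in reach (W_code k) n i.+1.
Proof.
move=> [_ [wname [bname [wP bP bb ws wsurj]]]].
by rewrite (near_reach bP bb ws wsurj) bb.
Qed.

Lemma W_word_run (k : 'I_32) mirror r (r12 : r < 12) :
  let m := image_word (W_table k) mirror r in
  image_runs (W_table k) mirror r m /\ word_weight m = nedges (W_table k).
Proof.
have /(all_nthP (Table 0 [::] [::] [::]))/(_ k) := W_words_run.
rewrite size_tables => /(_ (ltn_ord k))/allP/(_ _ (mem_motions mirror r12)).
by case/andP => ? /eqP.
Qed.

Lemma W_table_gt0 (k : 'I_32) : 0 < nedges (W_table k).
Proof.
have : all (fun T => 0 < nedges T) W_tables by vm_compute.
by move/(all_nthP (Table 0 [::] [::] [::])); apply; rewrite size_tables.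
Qed.

Lemma classification w (nonell : non_elliptic w) :
  exists (k : 'I_32) mirror r, [/\ r < 12,
    word_collapses w (image_word (W_table k) mirror r) &
    disk_image mirror (dihedral mirror r) (W_web k) w].
Proof.
have [m wm] := non_elliptic_word nonell W_words_survey.
rewrite mem_undup => /allpairsP[[k [mirror r]] [+ gm mE]].
rewrite mem_iota => k32.
have {gm}r12 : r < 12.
  by case/allpairsP: gm => -[m' r'] [_ + [_ ->]]; rewrite mem_iota.
exists (Ordinal k32), mirror, r.
have [runm wt] := W_word_run (Ordinal k32) mirror r12.
split; rewrite // -?mE //.
apply: (@disk_image_of_word _ _ _ _ _ _ nonell (W_table_gt0 _)) runm wt.
  exact: encodes_W_non_elliptic (W_encodes _).
by rewrite -mE.
Qed.

Lemma unshift_dihedral mirror r x : x < 12 ->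
  dihedral mirror r (Ordinal (unshift_lt mirror r x)) = x :> nat.
Proof.
move=> x12; have [g gK gK'] := dihedral_bij mirror r.
rewrite -[RHS]/(nat_of_ord (Ordinal x12)) -[in RHS](gK' (Ordinal x12)).
congr (nat_of_ord (dihedral _ _ _)); apply: ord_inj => /=.
by rewrite -{1}[x]/(nat_of_ord (Ordinal x12)) -{1}(gK' (Ordinal x12)) dihedral_unshift.
Qed.

(** The relation near is carried along by homeomorphisms and read off the incidences,
    so W_separated applies. *)
Lemma disk_image_W (j k : 'I_32) mirror r w :
  disk_image mirror (dihedral mirror r) (W_web j) w -> encodes (W_code k) w ->
  r < 12 ->
  j = k /\ image_word (W_table j) mirror r = image_word (W_table k) false 0.
Proof.
move=> im wk r12.
have nearE n (x y : 'I_12) : (y.+1 \in reach (W_code j) n x.+1) =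
    ((dihedral mirror r y).+1 \in reach (W_code k) n (dihedral mirror r x).+1).
  apply/idP/idP.
    by move/(near_code n x y (W_encodes j))/(disk_image_near im)/(near_code _ _ _ wk).
  by move/(near_code n _ _ wk)/(disk_image_near im)/(near_code _ _ _ (W_encodes j)).
have matE n : image_matrix (near_matrix (W_code j) n) mirror r = near_matrix (W_code k) n.
  apply/eq_in_map => x; rewrite mem_iota => x12; apply/eq_in_map => y; rewrite mem_iota => y12.
  rewrite (nth_map 0) ?size_iota ?unshift_lt // nth_iota ?unshift_lt // (nth_map 0)
    ?size_iota ?unshift_lt // nth_iota ?unshift_lt // !add0n.
  have := nearE n (Ordinal (unshift_lt mirror r x)) (Ordinal (unshift_lt mirror r y)).
  by rewrite !unshift_dihedral.
have nthE n (i : 'I_32) : nth [::] [seq near_matrix c n | c <- W_codes] i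
    = near_matrix (W_code i) n.
  by rewrite (nth_map [::]) //; exact: ltn_ord.
by apply: (separatedP W_separated r12); rewrite !nthE; exact: matE.
Qed.

Theorem theorem4p9 :
  exists W : 'I_32 -> web,
    [/\ (* W k is the unique web with the k-th list of incidences *)
        forall k : 'I_32, encodes (W_code k) (W k),
        forall (k : 'I_32) (w : web), encodes (W_code k) w -> isotopic (W k) w,
        (* the non-elliptic webs are exactly the dihedral translates of W *)
        forall w : web,
          non_elliptic w <-> exists k : 'I_32, dihedral_translate (W k) w
      & (* different W k are not dihedral translates of each other *)
        forall j k : 'I_32, dihedral_translate (W j) (W k) -> j = k].
Proof.
exists W_web; have W_nonell k := encodes_W_non_elliptic (W_encodes k).
split; first exact: W_encodes.
- move=> k w wk; have nonell := encodes_W_non_elliptic wk.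
  have [j [mirror [r [r12 wm im]]]] := classification nonell.
  have [_ mE] := disk_image_W im wk r12; rewrite mE in wm.
  have [runm wt] := W_word_run k false (isT : 0 < 12).
  exact: (disk_image_of_word (W_nonell k) nonell (W_table_gt0 k) wm runm wt).
- move=> w; split=> [nonell|[k [mirror [r im]]]].
    by have [k [mirror [r [_ _ im]]]] := classification nonell; exists k, mirror, r.
  exact: disk_image_non_elliptic (dihedral_bij mirror r) im (W_nonell k).
move=> j k [mirror [r im]].
have im' : disk_image mirror (dihedral mirror (r %% 12)) (W_web j) (W_web k).
  case: im => fe [fl [fr [bij [fw fb fbd fl' flr]]]]; exists fe, fl, fr; split=> //.
  by split=> // i; rewrite dihedral_mod.
by have [] := disk_image_W im' (W_encodes k) (ltn_pmod r (isT : 0 < 12)).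
Qed.
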